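(* Let $\gamma>0$ and let $g\in\mathcal{B}$ be a non-constant function satisfying $g',\frac1{g'}\in H^\infty$. (i) The optimal domains satisfy $[V_g,A^{-\gamma}]=[T_g,A^{-\gamma}]=A^{-(\gamma+1)}$ as linear subspaces of $H(\mathbb{D})$ and with equivalent norms. (ii) The optimal domains satisfy $[V_g,A^{-\gamma}_0]=[T_g,A^{-\gamma}_0]=A^{-(\gamma+1)}_0$ as linear subspaces of $H(\mathbb{D})$ and with equivalent norms.
   Context: $\mathbb{D}=\{z\in\mathbb{C}:|z|<1\}$; $H(\mathbb{D})$ is the Fréchet space of all analytic functions on $\mathbb{D}$ with the topology of uniform convergence on compact sets; $H^\infty$ is the space of bounded analytic functions on $\mathbb{D}$. The condition $\frac1{g'}\in H^\infty$ means that $g'$ has no zeros in $\mathbb{D}$ and $1/g'$ is bounded. For $g,f\in H(\mathbb{D})$, $(V_gf)(z):=\int_0^z f(\xi)g'(\xi)\,d\xi$ for $z\in\mathbb{D}$, and $(T_gf)(z):=\frac1z\int_0^z f(\xi)g'(\xi)\,d\xi$ for $z\in\mathbb{D}\setminus\{0\}$, $(T_gf)(0):=f(0)g'(0)$. For $\gamma>0$ the Korenblum growth spaces are $A^{-\gamma}:=\{f\in H(\mathbb{D}):\sup_{z\in\mathbb{D}}(1-|z|)^\gamma|f(z)|<\infty\}$ and $A^{-\gamma}_0:=\{f\in H(\mathbb{D}):\lim_{|z|\to1^-}(1-|z|)^\gamma|f(z)|=0\}$, both Banach spaces for the norm $\sup_{z\in\mathbb{D}}(1-|z|)^\gamma|f(z)|$.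 The Bloch space is $\mathcal{B}:=\{h\in H(\mathbb{D}):\sup_{z\in\mathbb{D}}(1-|z|)|h'(z)|<\infty\}$. For $X$ a Banach space continuously included in $H(\mathbb{D})$ and $T\colon H(\mathbb{D})\to H(\mathbb{D})$ continuous linear with $T(X)\subseteq X$, the optimal domain is $[T,X]:=\{f\in H(\mathbb{D}):Tf\in X\}$ with (semi-)norm $\|f\|_{[T,X]}:=\|Tf\|_X$. *)

(* Defs.v *)
From Stdlib Require Import Reals.
From Coquelicot Require Import Coquelicot.
Open Scope R_scope.

(* Elements of H(D) are total functions C -> C, analytic on the open unit disc;
   their values off the disc are irrelevant: every space, norm and operator
   below only depends on the restriction to the disc. *)
Definition disc (z : C) : Prop := Cmod z < 1.

Definition analytic (f : C -> C) : Prop :=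
  forall z : C, disc z -> ex_derive (K := C_AbsRing) (V := C_NormedModule) f z.

Definition sup_disc (F : C -> R) : Rbar :=
  Lub_Rbar (fun r : R => exists z : C, disc z /\ r = F z).

Definition Hinf (f : C -> C) : Prop :=
  analytic f /\ Rbar_lt (sup_disc (fun z => Cmod (f z))) p_infty.

(* The non-vanishing clause is needed because Coquelicot's Cinv is total. *)
Definition recip_Hinf (f : C -> C) : Prop :=
  (forall z : C, disc z -> f z <> RtoC 0) /\ Hinf (fun z => Cinv (f z)).

Definition nonconstant (f : C -> C) : Prop :=
  ~ exists c : C, forall z : C, disc z -> f z = c.

Definition Bloch (h : C -> C) : Prop :=
  analytic h /\
  Rbar_lt (sup_disc (fun z => (1 - Cmod z) * Cmod (C_derive h z))) p_infty.

(* A subspace of H(D) together with a (semi-)norm. The record carries no axioms,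
   and [snorm] is meaningful on [carrier] only (in particular [real] below sends
   an infinite supremum to 0, but only off the carrier). *)
Record space : Type := mkspace {
  carrier : (C -> C) -> Prop;
  snorm : (C -> C) -> R
}.

Definition weighted (gamma : R) (f : C -> C) (z : C) : R :=
  Rpower (1 - Cmod z) gamma * Cmod (f z).

Definition korenblum_norm (gamma : R) (f : C -> C) : R :=
  real (sup_disc (weighted gamma f)).

Definition korenblum (gamma : R) : space :=
  mkspace
    (fun f => analytic f /\ Rbar_lt (sup_disc (weighted gamma f)) p_infty)
    (korenblum_norm gamma).

Definition korenblum0 (gamma : R) : space :=
  mkspace
    (fun f => analytic f /\
      forall eps : R, 0 < eps -> exists delta : R, 0 < delta /\
        forall z : C, 1 - delta < Cmod z < 1 -> weighted gamma f z < eps)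
    (korenblum_norm gamma).

(* Integral of h from 0 to z, along the segment t |-> t z, 0 <= t <= 1. For h
   analytic on the disc the choice of path is immaterial. *)
Definition path_int (h : C -> C) (z : C) : C :=
  RInt (V := C_R_CompleteNormedModule)
    (fun t : R => (h (RtoC t * z) * z)%C) 0 1.

Definition Vop (g f : C -> C) (z : C) : C :=
  path_int (fun xi => (f xi * C_derive g xi)%C) z.

Definition Top (g f : C -> C) (z : C) : C :=
  if Ceq_dec z (RtoC 0)
  then (f (RtoC 0) * C_derive g (RtoC 0))%C
  else (/ z * path_int (fun xi => (f xi * C_derive g xi)%C) z)%C.

Definition optimal_domain (T : (C -> C) -> (C -> C)) (X : space) : space :=
  mkspace
    (fun f => analytic f /\ carrier X (T f))
    (fun f => snorm X (T f)).

Definition equivalent_norms (X Y : space) : Prop :=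
  exists a b : R, 0 < a /\ 0 < b /\
    forall f : C -> C, carrier X f ->
      a * snorm X f <= snorm Y f <= b * snorm X f.

Definition same_space (X Y : space) : Prop :=
  (forall f : C -> C, carrier X f <-> carrier Y f) /\ equivalent_norms X Y.

(* Main.v *)
(* Both operators integrate the analytic function [h = f g'], whose primitive
   [V f] exists by Goursat's theorem, and [T f (z) = V f (z) / z].  The three norms
   are compared in a cycle.  From [T f] to [V f] one uses [|z| <= 1].  From [V f]
   to [f = (V f)' / g'] one applies the Cauchy estimate on the disc of radius
   [(1 - |z|) / 2], which costs one power of [1 - |z|].  From [f] to [T f] one
   integrates the bound on [h] along the segment [[0, z]], which gains it back.
   The same inequalities, localised near the unit circle, treat the little-o spaces. *)

From Stdlib Require Import Reals Lra IndefiniteDescription.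
From Coquelicot Require Import Coquelicot.
(* Imported last: [Reals] also defines a [disc]. *)
Require Import Defs.
Open Scope R_scope.

(** Analyticity is bare complex differentiability, so everything is built from integrals along
    segments and real calculus on circles. The Cauchy estimate, for [F' = h], rests on a
    differential equation: for a fixed factor [u], the integral [G(s)] over [theta] of the real part
    of [u e^(-i theta) F(z + s e^(i theta))] satisfies [s G'(s) = G(s)], hence equals
    [2 pi s Re (u h(z))]. Choosing [u] to rotate [h(z)] onto the positive axis turns a bound on [F]
    into one on [h(z)]. Differentiating under the integral requires [h] to be continuous, which
    holds since [h = f g'] is analytic: membership of [g'] in [H^infty] includes its analyticity.
    The other delicate point is the origin, where [V f (z) / z] must be shown differentiable after
    filling in the value [h(0)]. Because the norm comparisons form a cycle, each equality of spaces
    and each two-sided norm bound follows from one edge of the cycle and the composite of the other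
    two. *)

Notation is_Cderive f z l :=
  (is_derive (K := C_AbsRing) (V := C_NormedModule) f z l).
Notation is_Rderive f t l :=
  (is_derive (K := R_AbsRing) (V := C_R_NormedModule) f t l).

(** * Complex differentiability and integrals along segments *)

Lemma is_Cderive_eps (f : C -> C) (z l : C) :
  is_Cderive f z l <->
  forall eps : R, 0 < eps -> exists delta : R, 0 < delta /\
    forall w : C, Cmod (w - z) < delta ->
      Cmod (f w - f z - l * (w - z))%C <= eps * Cmod (w - z).
Proof.
  split.
  - intros [_ H] eps Heps.
    destruct (H z (fun P HP => HP) (mkposreal eps Heps)) as [delta Hd].
    exists delta; split; [apply cond_pos|].
    intros w Hw.
    specialize (Hd w Hw).
    replace (f w - f z - l * (w - z))%C with (f w - f z - (w - z) * l)%C by ring.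
    exact Hd.
  - intros H; split; [apply is_linear_scal_l|].
    intros x Hx eps.
    rewrite <- (is_filter_lim_locally_unique _ _ Hx). clear x Hx.
    destruct (H eps (cond_pos eps)) as [delta [Hd0 Hd]].
    exists (mkposreal delta Hd0). intros w Hw.
    specialize (Hd w Hw).
    replace (f w - f z - l * (w - z))%C with (f w - f z - (w - z) * l)%C in Hd by ring.
    exact Hd.
Qed.

(** Multiplication by [l] is real-linear, so a complex derivative is in particular a real
    differential and the chain rule for real differentials applies. This is the passage from
    analytic functions to real-variable calculus along curves. *)
Lemma is_Cderive_comp (f : C -> C) (c : R -> C) (t : R) (l v : C) :
  is_Cderive f (c t) l -> is_Rderive c t v ->
  is_Rderive (fun s => f (c s)) t (l * v)%C.
Proof.
  intros Hf Hc.
  assert (Hl : is_linear (K := R_AbsRing) (U := C_R_NormedModule) (V := C_R_NormedModule)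
      (fun y : C => (l * y)%C)).
  { split.
    - intros x y. change (l * (x + y) = l * x + l * y)%C. ring.
    - intros k x. change (l * scal k x = scal k (l * x))%C. rewrite !scal_R_Cmult. ring.
    - exists (Cmod l + 1). split. generalize (Cmod_ge_0 l); lra.
      intros x. rewrite <- !Cmod_norm, Cmod_mult. generalize (Cmod_ge_0 x); nra. }
  assert (Hd : filterdiff (K := R_AbsRing) (U := C_R_NormedModule) (V := C_R_NormedModule)
      f (filtermap c (locally t)) (fun y : C => (l * y)%C)).
  { apply (filterdiff_locally (K := R_AbsRing) (U := C_R_NormedModule) f (c t)).
    - apply ex_derive_continuous. now exists v.
    - split; [exact Hl|].
      intros x Hx eps.
      rewrite <- (is_filter_lim_locally_unique _ _ Hx). clear x Hx.
      (* The filter here is built on the product balls of [R x R], the complex derivative on modulus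
         balls; both define the same neighbourhoods. *)
      apply locally_C.
      destruct (proj1 (is_Cderive_eps f (c t) l) Hf eps (cond_pos eps)) as [d [Hd0 Hd]].
      exists (mkposreal d Hd0). intros w Hw. rewrite <- !Cmod_norm.
      exact (Hd w Hw). }
  unfold is_derive.
  eapply filterdiff_ext_lin.
  apply (filterdiff_comp c f _ _ Hc Hd).
  intros y. simpl. change (l * scal y v = scal y (l * v))%C.
  rewrite !scal_R_Cmult. ring.
Qed.

Lemma is_Rderive_pair (x y : R -> R) (t vx vy : R) :
  is_derive x t vx -> is_derive y t vy ->
  is_Rderive (fun s => (x s, y s) : C) t ((vx, vy) : C).
Proof.
  intros Hx Hy.
  eapply filterdiff_ext_lin.
  apply (filterdiff_comp_2 (K := R_AbsRing) (T := R_NormedModule)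
    (U := R_NormedModule) (V := R_NormedModule) (W := C_R_NormedModule)
    x y (fun u v => (u, v) : C) _ _ (fun u v => (u, v) : C) Hx Hy).
  apply (filterdiff_ext (K := R_AbsRing) (fun p => p)).
  now intros [u v].
  eapply filterdiff_ext_lin. apply filterdiff_id.
  now intros [u v].
  reflexivity.
Qed.

Lemma is_derive_fst (c : R -> C) (t : R) (v : C) :
  is_Rderive c t v -> is_derive (fun s => fst (c s)) t (fst v).
Proof.
  intros Hc.
  eapply filterdiff_ext_lin.
  apply (filterdiff_comp (K := R_AbsRing) (V := C_R_NormedModule) (W := R_NormedModule)
    c (fun p : C => fst p) _ (fun p : C => fst p) Hc).
  apply filterdiff_linear, (is_linear_fst (U := R_NormedModule) (V := R_NormedModule)).
  reflexivity.
Qed.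

Lemma is_derive_snd (c : R -> C) (t : R) (v : C) :
  is_Rderive c t v -> is_derive (fun s => snd (c s)) t (snd v).
Proof.
  intros Hc.
  eapply filterdiff_ext_lin.
  apply (filterdiff_comp (K := R_AbsRing) (V := C_R_NormedModule) (W := R_NormedModule)
    c (fun p : C => snd p) _ (fun p : C => snd p) Hc).
  apply filterdiff_linear, (is_linear_snd (U := R_NormedModule) (V := R_NormedModule)).
  reflexivity.
Qed.

Lemma is_Cderive_mult (f h : C -> C) (z df dh : C) :
  is_Cderive f z df -> is_Cderive h z dh ->
  is_Cderive (fun w => f w * h w)%C z (df * h z + f z * dh)%C.
Proof.
  intros [_ Hf] [_ Hh].
  assert (H : is_derive (K := C_AbsRing) (V := AbsRing_NormedModule C_AbsRing)
    (fun w => f w * h w)%C z (df * h z + f z * dh)%C).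
  { apply (is_derive_mult (K := C_AbsRing) f h z df dh).
    - split; [apply is_linear_scal_l|exact Hf].
    - split; [apply is_linear_scal_l|exact Hh].
    - exact Cmult_comm. }
  split; [apply is_linear_scal_l|exact (proj2 H)].
Qed.

Lemma is_Cderive_inv (z : C) :
  z <> RtoC 0 -> is_Cderive Cinv z (- / (z * z))%C.
Proof.
  intros Hz. apply is_Cderive_eps. intros eps Heps.
  assert (Hm : 0 < Cmod z) by now apply Cmod_gt_0.
  set (m := Cmod z) in *.
  (* The remainder has modulus [|w - z|^2 / (|w| m^2)]. The first bound keeps [|w| > m / 2], and the
     second then makes the remainder at most [eps |w - z|]. *)
  exists (Rmin (m / 2) (eps * (m * m * m) / 2)). split.
  { apply Rmin_pos. lra. repeat apply Rmult_lt_0_compat; lra. }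
  intros w Hw.
  assert (Hw1 := Rlt_le_trans _ _ _ Hw (Rmin_l _ _)).
  assert (Hw2 := Rlt_le_trans _ _ _ Hw (Rmin_r _ _)).
  assert (Hwm : m / 2 < Cmod w).
  { assert (H := Cmod_triangle w (z - w)%C).
    replace (w + (z - w))%C with z in H by ring.
    replace (z - w)%C with (- (w - z))%C in H by ring.
    rewrite Cmod_opp in H. fold m in H. lra. }
  assert (Hw0 : w <> RtoC 0).
  { apply Cmod_gt_0. lra. }
  replace (/ w - / z - - / (z * z) * (w - z))%C
    with ((w - z) * (w - z) * / (w * (z * z)))%C by (field; now split).
  rewrite !Cmod_mult, Cmod_inv, !Cmod_mult; fold m.
  2: { repeat apply Cmult_neq_0; assumption. }
  set (e := Cmod (w - z)) in *. set (k := Cmod w) in *.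
  assert (0 <= e) by apply Cmod_ge_0.
  rewrite Rmult_assoc, (Rmult_comm eps).
  apply Rmult_le_compat_l; trivial.
  assert (0 < m * m) by now apply Rmult_lt_0_compat.
  assert (0 < k * (m * m)) by (apply Rmult_lt_0_compat; lra).
  apply (Rmult_le_reg_r (k * (m * m))); trivial.
  rewrite Rmult_assoc, Rinv_l by lra.
  rewrite Rmult_1_r.
  apply Rlt_le, Rlt_le_trans with (1 := Hw2).
  assert (0 < eps * (m * m)) by now apply Rmult_lt_0_compat.
  nra.
Qed.

Lemma analytic_mult (f h : C -> C) :
  analytic f -> analytic h -> analytic (fun w => f w * h w)%C.
Proof.
  intros Hf Hh z Hz.
  destruct (Hf z Hz) as [df Hdf], (Hh z Hz) as [dh Hdh].
  eexists. apply is_Cderive_mult; eassumption.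
Qed.

Lemma analytic_eps_continuous (h : C -> C) (z : C) :
  analytic h -> disc z ->
  forall eps : R, 0 < eps -> exists delta : R, 0 < delta /\
    forall w : C, Cmod (w - z)%C < delta -> Cmod (h w - h z)%C <= eps.
Proof.
  intros Hh Hz eps Heps.
  destruct (Hh z Hz) as [l Hl].
  destruct (proj1 (is_Cderive_eps h z l) Hl 1 Rlt_0_1) as [d [Hd0 Hd]].
  assert (Hl0 := Cmod_ge_0 l).
  exists (Rmin d (eps / (1 + Cmod l))). split.
  { apply Rmin_pos; trivial. apply Rdiv_lt_0_compat; lra. }
  intros w Hw.
  specialize (Hd w (Rlt_le_trans _ _ _ Hw (Rmin_l _ _))).
  assert (Hw2 := Rlt_le_trans _ _ _ Hw (Rmin_r _ _)).
  replace (h w - h z)%C with ((h w - h z - l * (w - z)) + l * (w - z))%C by ring.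
  eapply Rle_trans; [apply Cmod_triangle|].
  rewrite Cmod_mult.
  apply Rlt_div_r in Hw2; lra.
Qed.

Lemma Cmod_convex (a b : C) (t r : R) :
  0 <= t <= 1 -> Cmod a <= r -> Cmod b <= r ->
  Cmod (a + RtoC t * (b - a))%C <= r.
Proof.
  intros Ht Ha Hb.
  replace (a + RtoC t * (b - a))%C with (RtoC (1 - t) * a + RtoC t * b)%C
    by (rewrite RtoC_minus; ring).
  eapply Rle_trans; [apply Cmod_triangle|].
  rewrite !Cmod_mult, !Cmod_R, !Rabs_pos_eq by lra. nra.
Qed.

Lemma disc_segment (a b : C) (t : R) :
  disc a -> disc b -> 0 <= t <= 1 -> disc (a + RtoC t * (b - a))%C.
Proof.
  intros Ha Hb Ht. unfold disc in *.
  apply Rle_lt_trans with (Rmax (Cmod a) (Cmod b)).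
  - apply Cmod_convex; [trivial|apply Rmax_l|apply Rmax_r].
  - now apply Rmax_lub_lt.
Qed.

Lemma is_Rderive_segment (a b : C) (t : R) :
  is_Rderive (fun s => a + RtoC s * (b - a))%C t (b - a)%C.
Proof.
  destruct a as [a1 a2], b as [b1 b2].
  apply (is_derive_ext (K := R_AbsRing) (V := C_R_NormedModule)
    (fun s => (a1 + s * (b1 - a1), a2 + s * (b2 - a2)) : C)).
  { intros s. apply injective_projections; simpl; ring. }
  apply is_Rderive_pair; simpl; auto_derive; trivial; ring.
Qed.

Definition segment_integrand (h : C -> C) (a b : C) (t : R) : C :=
  (h (a + RtoC t * (b - a)) * (b - a))%C.

Definition segment_int (h : C -> C) (a b : C) : C :=
  RInt (V := C_R_CompleteNormedModule) (segment_integrand h a b) 0 1.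

Lemma is_RInt_segment (h : C -> C) (a b : C) :
  analytic h -> disc a -> disc b ->
  is_RInt (V := C_R_NormedModule) (segment_integrand h a b) 0 1 (segment_int h a b).
Proof.
  intros Hh Ha Hb.
  apply (RInt_correct (V := C_R_CompleteNormedModule)).
  apply (ex_RInt_continuous (V := C_R_CompleteNormedModule)).
  rewrite Rmin_left, Rmax_right by lra.
  intros t Ht.
  assert (Hc : analytic (fun w => h w * (b - a))%C).
  { apply analytic_mult; trivial. intros z _. apply ex_derive_const. }
  destruct (Hc _ (disc_segment a b t Ha Hb Ht)) as [l Hl].
  apply (ex_derive_continuous (K := R_AbsRing) (V := C_R_NormedModule)).
  eexists.
  exact (is_Cderive_comp _ _ t l _ Hl (is_Rderive_segment a b t)).
Qed.

(** * Goursat's theorem and primitives *)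

Lemma segment_int_unique (h : C -> C) (a b l : C) :
  is_RInt (V := C_R_NormedModule) (segment_integrand h a b) 0 1 l ->
  segment_int h a b = l.
Proof. exact (is_RInt_unique (V := C_R_CompleteNormedModule) _ 0 1 l). Qed.

Lemma segment_int_rev (h : C -> C) (a b : C) :
  analytic h -> disc a -> disc b -> segment_int h b a = (- segment_int h a b)%C.
Proof.
  intros Hh Ha Hb. apply segment_int_unique.
  assert (H := is_RInt_segment h a b Hh Ha Hb).
  apply is_RInt_swap in H.
  replace 1 with (-1 * 0 + 1) in H at 1 by ring.
  replace 0 with (-1 * 1 + 1) in H at 2 by ring.
  apply (is_RInt_comp_lin (V := C_R_NormedModule)) in H.
  revert H. apply is_RInt_ext. intros t _.
  rewrite scal_R_Cmult. unfold segment_integrand.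
  replace (a + RtoC (-1 * t + 1) * (b - a))%C with (b + RtoC t * (a - b))%C
    by (rewrite RtoC_plus, RtoC_mult; ring).
  match goal with |- ?x = ?y => change (x = y :> C) end.
  ring.
Qed.

Lemma RtoC_2_neq_0 : RtoC 2 <> RtoC 0.
Proof. intros E. apply RtoC_inj in E. lra. Qed.

Definition midpoint (a b : C) : C := ((a + b) / 2)%C.

Lemma segment_int_midpoint (h : C -> C) (a b : C) :
  analytic h -> disc a -> disc b ->
  segment_int h a b =
  (segment_int h a (midpoint a b) + segment_int h (midpoint a b) b)%C.
Proof.
  intros Hh Ha Hb.
  assert (H := is_RInt_segment h a b Hh Ha Hb).
  assert (H1 : is_RInt (V := C_R_NormedModule) (segment_integrand h a b) 0 (1 / 2)
    (segment_int h a (midpoint a b))).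
  { assert (E : ex_RInt (V := C_R_CompleteNormedModule) (segment_integrand h a b) 0 (1/2)).
    { apply (ex_RInt_Chasles_1 (V := C_R_CompleteNormedModule)) with 1. lra.
      now exists (segment_int h a b). }
    destruct E as [l Hl].
    enough (segment_int h a (midpoint a b) = l) by now subst l.
    apply segment_int_unique.
    replace 0 with (/ 2 * 0 + 0) in Hl by ring.
    replace (1 / 2) with (/ 2 * 1 + 0) in Hl by field.
    apply (is_RInt_comp_lin (V := C_R_NormedModule)) in Hl.
    revert Hl. apply is_RInt_ext. intros t _.
    rewrite scal_R_Cmult. unfold segment_integrand, midpoint.
    replace (a + RtoC (/ 2 * t + 0) * (b - a))%C
      with (a + RtoC t * ((a + b) / 2 - a))%C.
    2: { rewrite RtoC_plus, RtoC_mult, RtoC_inv by lra. field; exact RtoC_2_neq_0. }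
    match goal with |- ?x = ?y => change (x = y :> C) end.
    rewrite RtoC_inv by lra. field; exact RtoC_2_neq_0. }
  assert (H2 : is_RInt (V := C_R_NormedModule) (segment_integrand h a b) (1 / 2) 1
    (segment_int h (midpoint a b) b)).
  { assert (E : ex_RInt (V := C_R_CompleteNormedModule) (segment_integrand h a b) (1/2) 1).
    { apply (ex_RInt_Chasles_2 (V := C_R_CompleteNormedModule)) with 0. lra.
      now exists (segment_int h a b). }
    destruct E as [l Hl].
    enough (segment_int h (midpoint a b) b = l) by now subst l.
    apply segment_int_unique.
    replace (1 / 2) with (/ 2 * 0 + / 2) in Hl by field.
    replace 1 with (/ 2 * 1 + / 2) in Hl by field.
    apply (is_RInt_comp_lin (V := C_R_NormedModule)) in Hl.
    revert Hl. apply is_RInt_ext. intros t _.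
    rewrite scal_R_Cmult. unfold segment_integrand, midpoint.
    replace (a + RtoC (/ 2 * t + / 2) * (b - a))%C
      with ((a + b) / 2 + RtoC t * (b - (a + b) / 2))%C.
    2: { rewrite RtoC_plus, RtoC_mult, RtoC_inv by lra. field; exact RtoC_2_neq_0. }
    match goal with |- ?x = ?y => change (x = y :> C) end.
    rewrite RtoC_inv by lra. field; exact RtoC_2_neq_0. }
  apply segment_int_unique.
  exact (is_RInt_Chasles (V := C_R_NormedModule) _ _ _ _ _ _ H1 H2).
Qed.

(** [P] is a primitive of the affine function [p + l (w - q)], whose integral is exactly
    [P b - P a]; the error is integrated over the length of the segment. The estimate serves three
    times: in Goursat's theorem, for the derivative of the primitive, and for the derivative of the
    mean at the origin. *)
Lemma segment_int_affine_approx (h : C -> C) (a b p l q : C) (eps : R) :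
  analytic h -> disc a -> disc b ->
  (forall t : R, 0 <= t <= 1 ->
     let w := (a + RtoC t * (b - a))%C in
     Cmod (h w - (p + l * (w - q)))%C <= eps) ->
  let P := fun w : C => (p * (w - q) + l * ((w - q) * (w - q)) / 2)%C in
  Cmod (segment_int h a b - (P b - P a))%C <= eps * Cmod (b - a).
Proof.
  intros Hh Ha Hb Hw P.
  set (k := fun w : C => (p + l * (w - q))%C).
  assert (Hk : forall w, is_Cderive k w l).
  { intros w. apply is_Cderive_eps. intros e He. exists 1. split. lra.
    intros v _. unfold k.
    replace (p + l * (v - q) - (p + l * (w - q)) - l * (v - w))%C with (RtoC 0) by ring.
    rewrite Cmod_0. apply Rmult_le_pos. lra. apply Cmod_ge_0. }
  assert (HP : forall w, is_Cderive P w (k w)).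
  { intros w. apply is_Cderive_eps. intros e He.
    assert (Hl := Cmod_ge_0 l).
    exists (e / (Cmod l + 1)). split. apply Rdiv_lt_0_compat; lra.
    intros v Hv. unfold P, k.
    match goal with |- Cmod ?x <= _ => replace x with (l * / 2 * (v - w) * (v - w))%C by (field; exact RtoC_2_neq_0) end.
    rewrite !Cmod_mult, Cmod_inv, Cmod_R, Rabs_pos_eq.
    2: lra.
    2: exact RtoC_2_neq_0.
    apply Rmult_le_compat_r. apply Cmod_ge_0.
    assert (H0 := Cmod_ge_0 (v - w)).
    apply Rlt_div_r in Hv; [|lra]. nra. }
  assert (HkI : is_RInt (V := C_R_NormedModule)
     (segment_integrand k a b) 0 1 (P b - P a)%C).
  { assert (Hkan : analytic k) by (intros z _; now exists l).
    enough (segment_int k a b = P b - P a)%C as <-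
      by now apply is_RInt_segment.
    apply segment_int_unique.
    replace (P b - P a)%C with (minus (P (a + RtoC 1 * (b - a))%C) (P (a + RtoC 0 * (b - a))%C)
      : C_R_NormedModule).
    2: { replace (a + RtoC 1 * (b - a))%C with b by ring.
         replace (a + RtoC 0 * (b - a))%C with a by ring. reflexivity. }
    apply (is_RInt_derive (V := C_R_CompleteNormedModule)
      (fun t => P (a + RtoC t * (b - a))%C)).
    - intros t _.
      exact (is_Cderive_comp P _ t _ _ (HP _) (is_Rderive_segment a b t)).
    - intros t _.
      apply (ex_derive_continuous (K := R_AbsRing) (V := C_R_NormedModule)).
      eexists. unfold segment_integrand.
      assert (Hc : is_Cderive (fun w => k w * (b - a))%C (a + RtoC t * (b - a))%C
        (l * (b - a) + k (a + RtoC t * (b - a)) * 0)%C).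
      { exact (is_Cderive_mult k (fun _ => b - a)%C _ l 0 (Hk _)
          (is_derive_const (K := C_AbsRing) (V := C_NormedModule) (b - a)%C _)). }
      exact (is_Cderive_comp _ _ t _ _ Hc (is_Rderive_segment a b t)). }
  assert (HhI := is_RInt_segment h a b Hh Ha Hb).
  assert (HI := is_RInt_minus (V := C_R_NormedModule) _ _ _ _ _ _ HhI HkI).
  rewrite Cmod_norm.
  replace (eps * Cmod (b - a)) with ((1 - 0) * (eps * Cmod (b - a))) by ring.
  refine (norm_RInt_le_const _ 0 1 _ _ Rle_0_1 _ HI).
  intros t Ht. rewrite <- Cmod_norm.
  change (Cmod (segment_integrand h a b t - segment_integrand k a b t) <= eps * Cmod (b - a)).
  unfold segment_integrand.
  rewrite <- (Cmult_comm (b - a)), <- (Cmult_comm (b - a) (k _)).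
  match goal with |- Cmod (?u * ?x - ?u * ?y) <= _ =>
    replace (u * x - u * y)%C with ((x - y) * u)%C by ring end.
  rewrite Cmod_mult. apply Rmult_le_compat_r. apply Cmod_ge_0.
  exact (Hw t Ht).
Qed.

Definition triangle : Type := (C * C * C)%type.

Definition triangle_int (h : C -> C) (T : triangle) : C :=
  let '(a, b, c) := T in (segment_int h a b + segment_int h b c + segment_int h c a)%C.

(** The bound [r] on the vertices keeps the whole triangle in the disc by convexity and survives
    subdivision; the bound [d] on the sides is halved by it. *)
Definition triangle_within (r d : R) (T : triangle) : Prop :=
  let '(a, b, c) := T in
  (Cmod a <= r /\ Cmod b <= r /\ Cmod c <= r) /\
  (Cmod (b - a)%C <= d /\ Cmod (c - b)%C <= d /\ Cmod (a - c)%C <= d).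

Definition apex (T : triangle) : C := fst (fst T).

(** The vertex orders of the four children preserve the orientation, so that each edge joining two
    midpoints is run once in each direction. *)
Definition child_corner1 (T : triangle) : triangle :=
  let '(a, b, c) := T in (a, midpoint a b, midpoint c a).
Definition child_corner2 (T : triangle) : triangle :=
  let '(a, b, c) := T in (midpoint a b, b, midpoint b c).
Definition child_corner3 (T : triangle) : triangle :=
  let '(a, b, c) := T in (midpoint c a, midpoint b c, c).
Definition child_middle (T : triangle) : triangle :=
  let '(a, b, c) := T in (midpoint b c, midpoint c a, midpoint a b).

(** Deciding the order on [R] makes the selection a function, so the nested triangles are plain
    iterates. The middle child is the fallback: when all three corners fall below a quarter, it
    cannot. *)
Definition goursat_child (h : C -> C) (T : triangle) : triangle :=
  let big T' := Rle_dec (Cmod (triangle_int h T) / 4) (Cmod (triangle_int h T')) in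
  if big (child_corner1 T) then child_corner1 T
  else if big (child_corner2 T) then child_corner2 T
  else if big (child_corner3 T) then child_corner3 T
  else child_middle T.

Lemma Cmod_half (z : C) : Cmod (z / 2)%C = Cmod z / 2.
Proof.
  rewrite Cmod_div by exact RtoC_2_neq_0.
  now rewrite Cmod_R, Rabs_pos_eq by lra.
Qed.

Lemma Cmod_midpoint_le (a b : C) (r : R) :
  Cmod a <= r -> Cmod b <= r -> Cmod (midpoint a b) <= r.
Proof.
  intros Ha Hb. unfold midpoint. rewrite Cmod_half.
  generalize (Cmod_triangle a b). lra.
Qed.

Lemma Cmod_minus_sym (a b : C) : Cmod (a - b)%C = Cmod (b - a)%C.
Proof. replace (a - b)%C with (- (b - a))%C by ring. apply Cmod_opp. Qed.

Lemma goursat_child_within (h : C -> C) (T : triangle) (r d : R) :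
  triangle_within r d T ->
  triangle_within r (d / 2) (goursat_child h T) /\
  Cmod (apex (goursat_child h T) - apex T)%C <= d.
Proof.
  destruct T as [[a b] c]. intros [[Ha [Hb Hc]] [Hab [Hbc Hca]]].
  assert (H0 := Cmod_ge_0 (b - a)).
  assert (E1 : forall u v w : C, (midpoint u v - midpoint w u = (v - w) / 2)%C)
    by (intros; unfold midpoint; field; exact RtoC_2_neq_0).
  assert (E2 : forall u v w : C, (midpoint w u - midpoint u v = (w - v) / 2)%C)
    by (intros; unfold midpoint; field; exact RtoC_2_neq_0).
  assert (E3 : forall u v : C, (midpoint u v - u = (v - u) / 2)%C)
    by (intros; unfold midpoint; field; exact RtoC_2_neq_0).
  assert (E4 : forall u v : C, (midpoint u v - v = (u - v) / 2)%C)
    by (intros; unfold midpoint; field; exact RtoC_2_neq_0).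
  assert (E5 : forall u v : C, (u - midpoint u v = (u - v) / 2)%C)
    by (intros; unfold midpoint; field; exact RtoC_2_neq_0).
  assert (E6 : forall u v : C, (v - midpoint u v = (v - u) / 2)%C)
    by (intros; unfold midpoint; field; exact RtoC_2_neq_0).
  (* The middle child has the midpoint of [b c] as its apex, so its apex moves along a median,
     bounded by the average of the two sides at [a]. *)
  assert (Hm : Cmod (midpoint b c - a)%C <= d).
  { replace (midpoint b c - a)%C with (((b - a) + (c - a)) / 2)%C
      by (unfold midpoint; field; exact RtoC_2_neq_0).
    rewrite Cmod_half. generalize (Cmod_triangle (b - a) (c - a)).
    rewrite (Cmod_minus_sym c a). lra. }
  assert (Hz : (a - a = 0)%C) by ring.
  unfold goursat_child.
  repeat destruct Rle_dec; simpl; unfold apex; simpl;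
    repeat split; try apply Cmod_midpoint_le; trivial;
    rewrite ?E1, ?E2, ?E3, ?E4, ?E5, ?E6, ?Hz, ?Cmod_0, ?Cmod_half; trivial;
    try (rewrite 1?(Cmod_minus_sym b a), 1?(Cmod_minus_sym c b), 1?(Cmod_minus_sym a c) in *; lra);
    try lra.
Qed.

(** The inner edges cancel in pairs, so the integral is the sum of those over the four children, one
    of which has at least a quarter of its modulus. *)
Lemma triangle_int_le_child (h : C -> C) (T : triangle) (r d : R) :
  analytic h -> r < 1 -> triangle_within r d T ->
  Cmod (triangle_int h T) / 4 <= Cmod (triangle_int h (goursat_child h T)).
Proof.
  destruct T as [[a b] c]. intros Hh Hr [[Ha [Hb Hc]] _].
  assert (Hd : forall u : C, Cmod u <= r -> disc u) by (intros u Hu; unfold disc; lra).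
  assert (HD : forall u v : C, Cmod u <= r -> Cmod v <= r -> disc (midpoint u v))
    by (intros; apply Hd, Cmod_midpoint_le; trivial).
  set (T := (a, b, c) : triangle).
  assert (E : triangle_int h T =
    (triangle_int h (child_corner1 T) + triangle_int h (child_corner2 T)
     + triangle_int h (child_corner3 T) + triangle_int h (child_middle T))%C).
  { simpl.
    rewrite (segment_int_midpoint h a b), (segment_int_midpoint h b c),
      (segment_int_midpoint h c a) by auto.
    rewrite (segment_int_rev h (midpoint c a) (midpoint a b)),
      (segment_int_rev h (midpoint a b) (midpoint b c)),
      (segment_int_rev h (midpoint b c) (midpoint c a)) by auto.
    ring. }
  unfold goursat_child.
  repeat destruct Rle_dec; trivial.
  assert (H := Cmod_triangle (triangle_int h (child_corner1 T) + triangle_int h (child_corner2 T)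
     + triangle_int h (child_corner3 T)) (triangle_int h (child_middle T))).
  assert (H1 := Cmod_triangle (triangle_int h (child_corner1 T) + triangle_int h (child_corner2 T))
     (triangle_int h (child_corner3 T))).
  assert (H2 := Cmod_triangle (triangle_int h (child_corner1 T)) (triangle_int h (child_corner2 T))).
  rewrite <- E in H. lra.
Qed.

(** The intervals of radius [2 d / 2^n] around [x n] are nested; the supremum of their left ends
    lies in all of them, which gives the limit together with its rate. *)
Lemma geometric_steps_cv (x : nat -> R) (d : R) :
  (forall n, Rabs (x (S n) - x n) <= d / 2 ^ n) ->
  exists l, forall n, Rabs (x n - l) <= 2 * d / 2 ^ n.
Proof.
  intros Hx.
  assert (Hp : forall n, 0 < 2 ^ n) by (intros; apply pow_lt; lra).
  assert (Hd : 0 <= d).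
  { generalize (Hx O), (Rabs_pos (x 1%nat - x O)). simpl. lra. }
  assert (HS : forall n, 2 * d / 2 ^ S n = d / 2 ^ n).
  { intros n. simpl. field. generalize (Hp n); lra. }
  assert (HS2 : forall n, 2 * d / 2 ^ n = 2 * (d / 2 ^ n)).
  { intros n. field. generalize (Hp n); lra. }
  assert (Hpos : forall n, 0 <= d / 2 ^ n).
  { intros n. apply Rdiv_le_0_compat; auto. }
  assert (Hstep : forall n k, x (n + k)%nat - 2 * d / 2 ^ (n + k) >= x n - 2 * d / 2 ^ n /\
     x (n + k)%nat + 2 * d / 2 ^ (n + k) <= x n + 2 * d / 2 ^ n).
  { intros n k. induction k as [|k IH].
    - rewrite Nat.add_0_r. lra.
    - rewrite Nat.add_succ_r, HS.
      generalize (Hx (n + k)%nat). intros H. apply Rabs_le_between in H.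
      rewrite (HS2 (n + k)%nat) in IH. lra. }
  assert (Hlu : forall n m, x n - 2 * d / 2 ^ n <= x m + 2 * d / 2 ^ m).
  { intros n m.
    destruct (Hstep n m) as [H1 _], (Hstep m n) as [_ H2].
    rewrite (Nat.add_comm m n) in H2.
    generalize (Hpos (n + m)%nat). rewrite (HS2 (n + m)%nat) in H1, H2. lra. }
  destruct (completeness (fun y => exists n, y = x n - 2 * d / 2 ^ n)) as [l [Hl1 Hl2]].
  - exists (x O + 2 * d / 2 ^ 0). intros y [n ->]. apply Hlu.
  - exists (x O - 2 * d / 2 ^ 0). now exists O.
  - exists l. intros n. apply Rabs_le_between.
    assert (H1 : x n - 2 * d / 2 ^ n <= l) by (apply Hl1; now exists n).
    assert (H2 : l <= x n + 2 * d / 2 ^ n) by (apply Hl2; intros y [m ->]; apply Hlu).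
    lra.
Qed.

Lemma Cmod_le_Rabs (z : C) : Cmod z <= Rabs (fst z) + Rabs (snd z).
Proof.
  unfold Cmod.
  assert (H1 := Rabs_pos (fst z)). assert (H2 := Rabs_pos (snd z)).
  rewrite <- (sqrt_pow2 (Rabs (fst z) + Rabs (snd z))) by lra.
  apply sqrt_le_1_alt.
  rewrite <- (pow2_abs (fst z)), <- (pow2_abs (snd z)). nra.
Qed.

Lemma Cgeometric_steps_cv (x : nat -> C) (d : R) :
  (forall n, Cmod (x (S n) - x n)%C <= d / 2 ^ n) ->
  exists l : C, forall n, Cmod (x n - l)%C <= 4 * d / 2 ^ n.
Proof.
  intros Hx.
  destruct (geometric_steps_cv (fun n => fst (x n)) d) as [u Hu].
  { intros n. eapply Rle_trans; [|apply Hx].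
    apply (Rle_trans _ _ _ (Rmax_l _ _) (Rmax_Cmod (x (S n) - x n)%C)). }
  destruct (geometric_steps_cv (fun n => snd (x n)) d) as [v Hv].
  { intros n. eapply Rle_trans; [|apply Hx].
    apply (Rle_trans _ _ _ (Rmax_r _ _) (Rmax_Cmod (x (S n) - x n)%C)). }
  exists (u, v). intros n.
  eapply Rle_trans; [apply Cmod_le_Rabs|].
  generalize (Hu n), (Hv n). simpl.
  assert (Hp : 0 < 2 ^ n) by (apply pow_lt; lra).
  replace (4 * d / 2 ^ n) with (2 * d / 2 ^ n + 2 * d / 2 ^ n) by (field; lra).
  unfold Rminus. lra.
Qed.

Lemma pow2_inv_small (d eps : R) : 0 < eps -> exists n, d / 2 ^ n < eps.
Proof.
  intros He.
  destruct (Pow_x_infinity 2 ltac:(rewrite Rabs_pos_eq; lra) (d / eps + 1)) as [n Hn].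
  exists n. specialize (Hn n (Nat.le_refl n)).
  assert (Hp : 0 < 2 ^ n) by (apply pow_lt; lra).
  rewrite Rabs_pos_eq in Hn by lra.
  apply Rlt_div_l; trivial.
  assert (d = d / eps * eps) by (field; lra). nra.
Qed.

(** Every point of the boundary lies within [D = |apex T - p| + d] of [p], so there [h] differs from
    its affine expansion at [p] by at most [eps D]. The affine part has a primitive and contributes
    nothing around the closed contour; the three sides give the factor 3. *)
Lemma triangle_int_approx (h : C -> C) (T : triangle) (r d eps delta : R) (p l : C) :
  analytic h -> r < 1 -> 0 <= eps -> triangle_within r d T ->
  (forall w : C, Cmod (w - p)%C < delta ->
     Cmod (h w - h p - l * (w - p))%C <= eps * Cmod (w - p)%C) ->
  Cmod (apex T - p)%C + d < delta ->
  Cmod (triangle_int h T) <= 3 * (eps * (Cmod (apex T - p)%C + d) * d).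
Proof.
  destruct T as [[a b] c]. intros Hh Hr Heps [[Ha [Hb Hc]] [Hab [Hbc Hca]]] Hd Hdelta.
  unfold apex in *. simpl fst in *.
  set (D := Cmod (a - p)%C + d) in *.
  assert (Hdisc : forall u : C, Cmod u <= r -> disc u) by (intros u Hu; unfold disc; lra).
  assert (HaD : Cmod (a - p)%C <= D) by (unfold D; generalize (Cmod_ge_0 (b - a)); lra).
  assert (HbD : Cmod (b - p)%C <= D).
  { replace (b - p)%C with ((a - p) + (b - a))%C by ring.
    eapply Rle_trans; [apply Cmod_triangle|]. unfold D; lra. }
  assert (HcD : Cmod (c - p)%C <= D).
  { replace (c - p)%C with ((a - p) + (c - a))%C by ring.
    eapply Rle_trans; [apply Cmod_triangle|]. rewrite (Cmod_minus_sym c a). unfold D; lra. }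
  set (P := fun w : C => (h p * (w - p) + l * ((w - p) * (w - p)) / 2)%C).
  assert (HD0 : 0 <= D) by (generalize (Cmod_ge_0 (a - p)); lra).
  assert (Hseg : forall u v : C, Cmod u <= r -> Cmod v <= r -> Cmod (u - p)%C <= D ->
     Cmod (v - p)%C <= D -> Cmod (v - u)%C <= d ->
     Cmod (segment_int h u v - (P v - P u))%C <= eps * D * d).
  { intros u v Hu Hv Hup Hvp Huv.
    apply Rle_trans with (eps * D * Cmod (v - u)%C).
    2: { apply Rmult_le_compat_l; trivial. now apply Rmult_le_pos. }
    apply segment_int_affine_approx; auto.
    intros t Ht w.
    assert (Hw : Cmod (w - p)%C <= D).
    { unfold w.
      replace (u + RtoC t * (v - u) - p)%C with ((u - p) + RtoC t * ((v - p) - (u - p)))%C by ring.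
      now apply Cmod_convex. }
    replace (h w - (h p + l * (w - p)))%C with (h w - h p - l * (w - p))%C by ring.
    eapply Rle_trans; [apply Hd; lra|].
    now apply Rmult_le_compat_l. }
  simpl triangle_int.
  replace (segment_int h a b + segment_int h b c + segment_int h c a)%C with
    ((segment_int h a b - (P b - P a)) + (segment_int h b c - (P c - P b))
     + (segment_int h c a - (P a - P c)))%C by ring.
  eapply Rle_trans; [apply Cmod_triangle|].
  assert (H1 := Cmod_triangle (segment_int h a b - (P b - P a)) (segment_int h b c - (P c - P b))).
  generalize (Hseg a b Ha Hb HaD HbD Hab), (Hseg b c Hb Hc HbD HcD Hbc),
    (Hseg c a Hc Ha HcD HaD Hca). lra.
Qed.

(** Along the selected triangles the integral shrinks by at most a factor 4 per step, while
    differentiability at their common limit point bounds it by an arbitrarily small multiple of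
    [4^(-n)]. *)
Lemma goursat (h : C -> C) (a b c : C) :
  analytic h -> disc a -> disc b -> disc c ->
  (segment_int h a b + segment_int h b c + segment_int h c a = 0)%C.
Proof.
  intros Hh Ha Hb Hc.
  set (T0 := (a, b, c) : triangle).
  change (triangle_int h T0 = RtoC 0).
  set (r := Rmax (Cmod a) (Rmax (Cmod b) (Cmod c))).
  assert (Hr : r < 1) by (repeat apply Rmax_lub_lt; assumption).
  (* Including 1 keeps [d] positive for a degenerate triangle, since [eps] below divides by
     [d * d]. *)
  set (d := Rmax (Cmod (b - a)%C) (Rmax (Cmod (c - b)%C) (Rmax (Cmod (a - c)%C) 1))).
  assert (Hd1 : 1 <= d).
  { unfold d. eapply Rle_trans; [|apply Rmax_r]. eapply Rle_trans; [|apply Rmax_r].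
    apply Rmax_r. }
  assert (HT0 : triangle_within r d T0).
  { split; [split; [|split]|split; [|split]]; unfold r, d;
      repeat first [apply Rle_refl | apply Rmax_l | eapply Rle_trans; [|apply Rmax_r]]. }
  set (T := fun n => Nat.iter n (goursat_child h) T0).
  assert (Hp : forall n, 0 < 2 ^ n) by (intros; apply pow_lt; lra).
  assert (HT : forall n, triangle_within r (d / 2 ^ n) (T n)).
  { induction n as [|n IH].
    - simpl (d / 2 ^ 0). replace (d / 1) with d by field. exact HT0.
    - replace (d / 2 ^ S n) with (d / 2 ^ n / 2) by (simpl; field; generalize (Hp n); lra).
      exact (proj1 (goursat_child_within h (T n) r _ IH)). }
  assert (HI : forall n, Cmod (triangle_int h T0) / (2 ^ n * 2 ^ n) <= Cmod (triangle_int h (T n))).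
  { induction n as [|n IH].
    - simpl (2 ^ 0 * 2 ^ 0). unfold T; simpl Nat.iter. lra.
    - eapply Rle_trans; [|exact (triangle_int_le_child h (T n) r _ Hh Hr (HT n))].
      replace (Cmod (triangle_int h T0) / (2 ^ S n * 2 ^ S n))
        with (Cmod (triangle_int h T0) / (2 ^ n * 2 ^ n) / 4)
        by (simpl; field; generalize (Hp n); lra).
      lra. }
  destruct (Cgeometric_steps_cv (fun n => apex (T n)) d) as [p Hpl].
  { intros n. exact (proj2 (goursat_child_within h (T n) r _ (HT n))). }
  (* All apexes stay in the closed disc of radius [r < 1], so the limit cannot reach the unit
     circle. *)
  assert (Hpd : disc p).
  { destruct (pow2_inv_small (4 * d) (1 - r)) as [n Hn]; [lra|].
    generalize (Hpl n). intros H.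
    assert (Hap : Cmod (apex (T n)) <= r).
    { generalize (HT n). destruct (T n) as [[u v] w]. intros [[Hu _] _]. exact Hu. }
    assert (Ht := Cmod_triangle (apex (T n)) (p - apex (T n))).
    replace (apex (T n) + (p - apex (T n)))%C with p in Ht by ring.
    rewrite (Cmod_minus_sym p) in Ht. unfold disc. lra. }
  destruct (Hh p Hpd) as [l Hl].
  destruct (Rle_lt_or_eq_dec _ _ (Cmod_ge_0 (triangle_int h T0))) as [Hk|Hk].
  2: { now apply Cmod_eq_0. }
  exfalso. set (k := Cmod (triangle_int h T0)) in *.
  (* At stage [n] the contour estimate is [3 * eps * (5 d / 2^n) * (d / 2^n)], where 5 is the rate 4
     of the apexes plus 1 for the sides. It equals [15/16] of [k / 4^n], hence the choice of 16. *)
  set (eps := k / (16 * (d * d))).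
  assert (Hdd : 0 < d * d) by nra.
  assert (Heps : 0 < eps) by (apply Rdiv_lt_0_compat; lra).
  destruct (proj1 (is_Cderive_eps h p l) Hl eps Heps) as [delta [Hdelta Hw]].
  destruct (pow2_inv_small (5 * d) delta Hdelta) as [n Hn].
  set (q := 2 ^ n) in *.
  assert (Hq : 0 < q) by apply Hp.
  assert (Hapex : Cmod (apex (T n) - p)%C + d / q <= 5 * d / q).
  { replace (5 * d / q) with (4 * d / q + d / q) by (field; lra).
    generalize (Hpl n). fold q. lra. }
  assert (H := triangle_int_approx h (T n) r (d / q) eps delta p l Hh Hr
    (Rlt_le _ _ Heps) (HT n) Hw (Rle_lt_trans _ _ _ Hapex Hn)).
  assert (HIn := HI n). fold q in HIn.
  assert (Hdq : 0 < d / q) by (apply Rdiv_lt_0_compat; lra).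
  assert (H3 : 3 * (eps * (Cmod (apex (T n) - p)%C + d / q) * (d / q))
      <= 3 * (eps * (5 * d / q) * (d / q))).
  { apply Rmult_le_compat_l. lra. apply Rmult_le_compat_r. lra.
    apply Rmult_le_compat_l; lra. }
  assert (H4 : k / (q * q) <= 3 * (eps * (5 * d / q) * (d / q))) by lra.
  replace (3 * (eps * (5 * d / q) * (d / q))) with (k / (q * q) * (15 / 16)) in H4
    by (unfold eps; field; lra).
  assert (0 < k / (q * q)) by (apply Rdiv_lt_0_compat; nra).
  lra.
Qed.

Lemma path_int_segment (h : C -> C) (z : C) : path_int h z = segment_int h 0 z.
Proof.
  apply (RInt_ext (V := C_R_CompleteNormedModule)). intros t _.
  unfold segment_integrand.
  replace (0 + RtoC t * (z - 0))%C with (RtoC t * z)%C by ring.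
  now replace (z - 0)%C with z by ring.
Qed.

Lemma disc_0 : disc 0.
Proof. unfold disc. rewrite Cmod_0. lra. Qed.

Lemma disc_open (z : C) : disc z ->
  exists delta, 0 < delta /\ forall w : C, Cmod (w - z)%C < delta -> disc w.
Proof.
  intros Hz. exists (1 - Cmod z). unfold disc in *. split; [lra|].
  intros w Hw. generalize (Cmod_triangle (w - z) z).
  replace (w - z + z)%C with w by ring. lra.
Qed.

(** Goursat on the triangle [0, z, w] replaces a difference of radial integrals by the integral over
    the chord, whose length is [|w - z|]. *)
Lemma path_int_minus (h : C -> C) (z w : C) :
  analytic h -> disc z -> disc w ->
  (path_int h w - path_int h z = segment_int h z w)%C.
Proof.
  intros Hh Hz Hw. rewrite !path_int_segment.
  assert (H := goursat h 0 z w Hh disc_0 Hz Hw).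
  rewrite (segment_int_rev h 0 w Hh disc_0 Hw) in H.
  replace (segment_int h z w) with
    ((segment_int h 0 z + segment_int h z w + - segment_int h 0 w)
     + (segment_int h 0 w - segment_int h 0 z))%C by ring.
  rewrite H. ring.
Qed.

Lemma is_Cderive_path_int (h : C -> C) (z : C) :
  analytic h -> disc z -> is_Cderive (path_int h) z (h z).
Proof.
  intros Hh Hz. apply is_Cderive_eps. intros eps Heps.
  destruct (analytic_eps_continuous h z Hh Hz eps Heps) as [d1 [Hd1 H1]].
  destruct (disc_open z Hz) as [d2 [Hd2 H2]].
  exists (Rmin d1 d2). split; [now apply Rmin_pos|]. intros w Hw.
  assert (Hw1 := Rlt_le_trans _ _ _ Hw (Rmin_l _ _)).
  assert (Hw2 := Rlt_le_trans _ _ _ Hw (Rmin_r _ _)).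
  rewrite path_int_minus by auto.
  (* With slope 0 the affine comparison is with the constant [h z], and the hypothesis becomes
     continuity of [h] at [z]. *)
  assert (H := segment_int_affine_approx h z w (h z) 0 z eps Hh Hz (H2 w Hw2)).
  cbv beta zeta in H.
  match type of H with _ -> Cmod (_ - ?x)%C <= _ =>
    replace x with (h z * (w - z))%C in H by (field; exact RtoC_2_neq_0) end.
  apply H. intros t Ht.
  replace (h (z + t * (w - z)) - (h z + 0 * (z + t * (w - z) - z)))%C
    with (h (z + t * (w - z)) - h z)%C by ring.
  apply H1.
  replace (z + t * (w - z) - z)%C with (RtoC t * (w - z))%C by ring.
  rewrite Cmod_mult, Cmod_R, Rabs_pos_eq by lra.
  generalize (Cmod_ge_0 (w - z)). nra.
Qed.

Lemma analytic_path_int (h : C -> C) : analytic h -> analytic (path_int h).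
Proof. intros Hh z Hz. eexists. now apply is_Cderive_path_int. Qed.

Lemma path_int_0 (h : C -> C) : path_int h 0 = RtoC 0.
Proof.
  unfold path_int.
  rewrite (RInt_ext (V := C_R_CompleteNormedModule) _ (fun _ => RtoC 0)).
  - rewrite RInt_const. rewrite scal_R_Cmult. ring.
  - intros t _. match goal with |- ?x = ?y => change (x = y :> C) end. ring.
Qed.

(** For [h = f g'] this is [Top g f] by conversion. *)
Definition mean_path_int (h : C -> C) (z : C) : C :=
  if Ceq_dec z (RtoC 0) then h (RtoC 0) else (/ z * path_int h z)%C.

(** At the origin, integrating the first-order expansion of [h] along [[0, w]] gives
    [h(0) w + l w^2 / 2] up to [eps |w|^2]; after division by [w] the derivative is [l / 2].
    Elsewhere the product rule applies on a ball of radius [|z|], which misses the origin. *)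
Lemma analytic_mean_path_int (h : C -> C) :
  analytic h -> analytic (mean_path_int h).
Proof.
  intros Hh z Hz. destruct (Ceq_dec z (RtoC 0)) as [->|Hz0].
  - destruct (Hh _ Hz) as [l Hl]. exists (l / 2)%C.
    apply is_Cderive_eps. intros eps Heps.
    destruct (proj1 (is_Cderive_eps h (RtoC 0) l) Hl eps Heps) as [d1 [Hd1 H1]].
    exists (Rmin d1 1). split; [apply Rmin_pos; lra|]. intros w Hw.
    assert (Hw1 := Rlt_le_trans _ _ _ Hw (Rmin_l _ _)).
    assert (Hw2 := Rlt_le_trans _ _ _ Hw (Rmin_r _ _)).
    replace (w - 0)%C with w in * by ring.
    unfold mean_path_int.
    destruct (Ceq_dec 0 0) as [_|n]; [|now elim n].
    destruct (Ceq_dec w 0) as [->|Hw0].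
    { replace (h 0 - h 0 - l / 2 * 0)%C with (RtoC 0) by ring. rewrite Cmod_0. lra. }
    assert (Hm : 0 < Cmod w) by now apply Cmod_gt_0.
    assert (H := segment_int_affine_approx h 0 w (h 0) l 0 (eps * Cmod w) Hh disc_0 Hw2).
    cbv beta zeta in H.
    match type of H with _ -> Cmod (_ - ?x)%C <= _ =>
      replace x with (h 0 * w + l * (w * w) / 2)%C in H by (field; exact RtoC_2_neq_0) end.
    replace (/ w * path_int h w - h 0 - l / 2 * w)%C
      with ((segment_int h 0 w - (h 0 * w + l * (w * w) / 2)) / w)%C.
    2: { rewrite path_int_segment. field; repeat split; first [exact Hw0 | exact RtoC_2_neq_0]. }
    replace (w - 0)%C with w in H by ring.
    rewrite Cmod_div by trivial. apply Rle_div_l; trivial. apply H.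
    intros t Ht. replace (0 + t * w)%C with (RtoC t * w)%C by ring.
    assert (Ht2 : Cmod (t * w)%C <= Cmod w).
    { rewrite Cmod_mult, Cmod_R, Rabs_pos_eq by lra. nra. }
    specialize (H1 (RtoC t * w)%C).
    replace (t * w - 0)%C with (t * w)%C in * by ring.
    replace (h (t * w) - (h 0 + l * (t * w)))%C with (h (t * w) - h 0 - l * (t * w))%C by ring.
    eapply Rle_trans; [apply H1; lra|]. apply Rmult_le_compat_l; lra.
  - eexists.
    apply (is_derive_ext_loc (K := C_AbsRing) (V := C_NormedModule)
      (fun w => / w * path_int h w)%C).
    2: { apply is_Cderive_mult. now apply is_Cderive_inv.
         now apply is_Cderive_path_int. }
    exists (mkposreal (Cmod z) (proj1 (Cmod_gt_0 z) Hz0)).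
    intros w Hw. unfold mean_path_int.
    destruct (Ceq_dec w 0) as [E|]; trivial. exfalso. subst w.
    assert (Hw' : Cmod (0 - z)%C < Cmod z) by exact Hw.
    replace (0 - z)%C with (- z)%C in Hw' by ring.
    rewrite Cmod_opp in Hw'. lra.
Qed.

(** * The Cauchy estimate *)

(** A negative [s] is allowed, so that [s = 0] is an interior point of the range of radii and
    derivatives can be taken there. *)
Definition circle (z : C) (s theta : R) : C :=
  (fst z + s * cos theta, snd z + s * sin theta).

Lemma circle_minus (z : C) (s theta : R) : Cmod (circle z s theta - z)%C = Rabs s.
Proof.
  unfold Cmod, circle. simpl.
  rewrite <- sqrt_Rsqr_abs. f_equal. unfold Rsqr.
  generalize (sin2_cos2 theta). unfold Rsqr. intros H.
  transitivity (s * s * (sin theta * sin theta + cos theta * cos theta)); [ring|].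
  rewrite H. ring.
Qed.

Lemma circle_disc (z : C) (s theta : R) : Rabs s + Cmod z < 1 -> disc (circle z s theta).
Proof.
  intros H. unfold disc. rewrite <- (circle_minus z s theta) in H.
  eapply Rle_lt_trans; [|exact H].
  eapply Rle_trans; [|apply Cmod_triangle].
  right. f_equal. ring.
Qed.

Lemma Rabs_fst_mult_le (u w : C) : Cmod u <= 1 -> Rabs (fst (u * w)%C) <= Cmod w.
Proof.
  intros Hu. eapply Rle_trans; [apply (re_le_Cmod (u * w))|].
  rewrite Cmod_mult. generalize (Cmod_ge_0 w). nra.
Qed.

(** Joint continuity in radius and angle is what allows the radial derivative to pass under the
    integral over the angle. *)
Lemma continuity_2d_pt_circle (u z : C) (h : C -> C) (s theta : R) :
  Cmod u <= 1 -> analytic h -> Rabs s + Cmod z < 1 ->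
  continuity_2d_pt (fun x y => fst (u * h (circle z x y))%C) s theta.
Proof.
  intros Hu Hh Hs eps.
  assert (He : 0 < eps / 2) by (generalize (cond_pos eps); lra).
  destruct (analytic_eps_continuous h _ Hh (circle_disc z s theta Hs) _ He) as [d [Hd H]].
  assert (C1 : continuity_2d_pt (fun x y => fst z + x * cos y) s theta).
  { apply continuity_2d_pt_plus. apply continuity_2d_pt_const.
    apply continuity_2d_pt_mult. apply continuity_2d_pt_id1.
    apply (continuity_1d_2d_pt_comp cos (fun _ y => y)).
    apply continuity_cos. apply continuity_2d_pt_id2. }
  assert (C2 : continuity_2d_pt (fun x y => snd z + x * sin y) s theta).
  { apply continuity_2d_pt_plus. apply continuity_2d_pt_const.
    apply continuity_2d_pt_mult. apply continuity_2d_pt_id1.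
    apply (continuity_1d_2d_pt_comp sin (fun _ y => y)).
    apply continuity_sin. apply continuity_2d_pt_id2. }
  assert (Hd2 : 0 < d / 2) by lra.
  generalize (locally_2d_and _ _ _ _ (C1 (mkposreal _ Hd2)) (C2 (mkposreal _ Hd2))).
  apply locally_2d_impl. apply locally_2d_forall. intros x y [H1 H2]. simpl in H1, H2.
  replace (fst (u * h (circle z x y))%C - fst (u * h (circle z s theta))%C)
    with (fst (u * (h (circle z x y) - h (circle z s theta)))%C) by (simpl; ring).
  eapply Rle_lt_trans; [now apply Rabs_fst_mult_le|].
  eapply Rle_lt_trans; [apply H|lra].
  eapply Rle_lt_trans; [apply Cmod_le_Rabs|].
  simpl. unfold Rminus in H1, H2. lra.
Qed.

Section CauchyEstimate.

Context (F h : C -> C) (u z : C) (Hh : analytic h)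
  (HF : forall w, disc w -> is_Cderive F w (h w)) (Hu : Cmod u <= 1).

(* The factor [e^(-i theta)] makes the radial derivative
   [Re (u F'(z + s e^(i theta)))]; the free factor [u] reduces the complex estimate
   to a real one. *)
Definition circle_density (s theta : R) : R :=
  fst (u * (F (circle z s theta) * (cos theta, (- sin theta)%R)))%C.

Lemma is_derive_circle_density_radius (s theta : R) : Rabs s + Cmod z < 1 ->
  is_derive (fun x => circle_density x theta) s (fst (u * h (circle z s theta))%C).
Proof.
  intros Hs.
  assert (Hc : is_Rderive (fun x => circle z x theta) s (cos theta, sin theta)).
  { apply is_Rderive_pair; auto_derive; trivial; ring. }
  assert (HD := is_Cderive_comp F _ s _ _ (HF _ (circle_disc z s theta Hs)) Hc).
  set (p := fun x => fst (F (circle z x theta))).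
  set (q := fun x => snd (F (circle z x theta))).
  assert (D1 : is_derive p s _) by exact (is_derive_fst _ _ _ HD).
  assert (D2 : is_derive q s _) by exact (is_derive_snd _ _ _ HD).
  apply (is_derive_ext (fun x => fst u * (p x * cos theta + q x * sin theta)
     - snd u * (q x * cos theta - p x * sin theta))).
  { intros x. unfold circle_density, p, q. simpl. ring. }
  auto_derive.
  { repeat split; eexists; eassumption. }
  rewrite (is_derive_unique (fun x : R => p x) _ _ D1), (is_derive_unique (fun x : R => q x) _ _ D2).
  simpl. generalize (sin2_cos2 theta). unfold Rsqr. intros E.
  set (a := fst (h (circle z s theta))). set (b := snd (h (circle z s theta))).
  transitivity ((sin theta * sin theta + cos theta * cos theta) * (fst u * a - snd u * b));
    [ring|rewrite E; ring].
Qed.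

(** The imaginary counterpart of [circle_density]. Since [e^(-i theta) F] has angular derivative
    [i (s h - e^(-i theta) F)], multiplying by [u] and taking imaginary parts yields [s Re (u h)]
    minus the density. *)
Definition circle_antiderivative (s theta : R) : R :=
  snd (u * (F (circle z s theta) * (cos theta, (- sin theta)%R)))%C.

Lemma is_derive_circle_angle (s theta : R) : Rabs s + Cmod z < 1 ->
  is_derive (circle_antiderivative s) theta
    (s * fst (u * h (circle z s theta))%C - circle_density s theta) /\
  ex_derive (circle_density s) theta.
Proof.
  intros Hs.
  assert (Hc : is_Rderive (fun y => circle z s y) theta (- s * sin theta, s * cos theta)).
  { apply is_Rderive_pair; auto_derive; trivial; ring. }
  assert (HD := is_Cderive_comp F _ theta _ _ (HF _ (circle_disc z s theta Hs)) Hc).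
  unfold circle_antiderivative, circle_density.
  set (p := fun x => fst (F (circle z s x))).
  set (q := fun x => snd (F (circle z s x))).
  assert (D1 : is_derive p theta _) by exact (is_derive_fst _ _ _ HD).
  assert (D2 : is_derive q theta _) by exact (is_derive_snd _ _ _ HD).
  split.
  - apply (is_derive_ext (fun x => fst u * (q x * cos x - p x * sin x)
      + snd u * (p x * cos x + q x * sin x))).
    { intros x. unfold p, q. simpl. ring. }
    auto_derive.
    { repeat split; eexists; eassumption. }
    rewrite (is_derive_unique (fun x : R => p x) _ _ D1), (is_derive_unique (fun x : R => q x) _ _ D2).
    unfold p, q. simpl. generalize (sin2_cos2 theta). unfold Rsqr. intros E.
    set (a := fst (h (circle z s theta))). set (b := snd (h (circle z s theta))).
    (* A multiple of [1 - (sin^2 + cos^2)], which is zero, is added so that both sides agree as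
       polynomials. *)
    match goal with |- ?x = _ => transitivity
      (x + (1 - (sin theta * sin theta + cos theta * cos theta)) * s * (fst u * a - snd u * b)) end;
    [rewrite E; ring|ring].
  - apply (ex_derive_ext (fun x => fst u * (p x * cos x + q x * sin x)
     - snd u * (q x * cos x - p x * sin x))).
    { intros x. unfold p, q. simpl. ring. }
    auto_derive.
    repeat split; eexists; eassumption.
Qed.

Definition circle_mean (s : R) : R := RInt (circle_density s) 0 (2 * PI).

Definition circle_mean_derivative (s : R) : R :=
  RInt (fun theta => fst (u * h (circle z s theta))%C) 0 (2 * PI).

Lemma ex_RInt_circle_density (s : R) : Rabs s + Cmod z < 1 ->
  ex_RInt (circle_density s) 0 (2 * PI).
Proof.
  intros Hs. apply (ex_RInt_continuous (V := R_CompleteNormedModule)).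
  intros t _. apply (ex_derive_continuous (K := R_AbsRing) (V := R_NormedModule)). now apply is_derive_circle_angle.
Qed.

Lemma continuous_circle_angle (s theta : R) : Rabs s + Cmod z < 1 ->
  continuous (fun y => fst (u * h (circle z s y))%C) theta.
Proof.
  intros Hs. apply continuity_pt_filterlim.
  assert (H := continuity_2d_pt_circle u z h s theta Hu Hh Hs).
  apply continuity_pt_locally. intros eps.
  destruct (H eps) as [d Hd]. exists d. intros y Hy.
  apply Hd. rewrite Rminus_diag, Rabs_R0. apply cond_pos. exact Hy.
Qed.

Lemma is_derive_circle_mean (s : R) : Rabs s + Cmod z < 1 ->
  is_derive circle_mean s (circle_mean_derivative s).
Proof.
  intros Hs.
  assert (Hloc : locally s (fun x => Rabs x + Cmod z < 1)).
  { assert (Hd : 0 < 1 - Cmod z - Rabs s) by lra.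
    exists (mkposreal _ Hd). intros y Hy.
    change (Rabs (y - s) < 1 - Cmod z - Rabs s) in Hy.
    generalize (Rabs_triang_inv y s). lra. }
  assert (HE : circle_mean_derivative s =
    RInt (fun t => Derive (fun x => circle_density x t) s) 0 (2 * PI)).
  { apply RInt_ext. intros t _. symmetry.
    apply is_derive_unique. now apply is_derive_circle_density_radius. }
  rewrite HE.
  apply (is_derive_RInt_param circle_density).
  - revert Hloc. apply filter_imp. intros x Hx t _.
    eexists. now apply is_derive_circle_density_radius.
  - intros t _.
    apply (continuity_2d_pt_ext_loc (fun x y => fst (u * h (circle z x y))%C)).
    + destruct Hloc as [d Hd]. exists d. intros x y Hx _. symmetry.
      apply is_derive_unique. apply is_derive_circle_density_radius. now apply Hd.
    + now apply continuity_2d_pt_circle.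
  - revert Hloc. apply filter_imp. intros x Hx. now apply ex_RInt_circle_density.
Qed.

(* Integrating the angular derivative over a full turn gives [s G'(s) = G(s)]
   for [G := circle_mean], so [G(s) / s] does not depend on [s]. *)
Lemma circle_mean_euler (s : R) : Rabs s + Cmod z < 1 ->
  s * circle_mean_derivative s = circle_mean s.
Proof.
  intros Hs.
  assert (H : is_RInt (fun t => s * fst (u * h (circle z s t))%C - circle_density s t)
    0 (2 * PI) (circle_antiderivative s (2 * PI) - circle_antiderivative s 0)).
  { apply (is_RInt_derive (V := R_CompleteNormedModule) (circle_antiderivative s)).
    - intros t _. now apply is_derive_circle_angle.
    - intros t _. apply (continuous_minus (V := R_NormedModule)).
      + apply (continuous_scal_r (V := R_NormedModule) s). now apply continuous_circle_angle.
      + apply (ex_derive_continuous (K := R_AbsRing) (V := R_NormedModule)). now apply is_derive_circle_angle. }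
  assert (H1 : is_RInt (fun t => fst (u * h (circle z s t))%C) 0 (2 * PI)
     (circle_mean_derivative s)).
  { apply (RInt_correct (V := R_CompleteNormedModule)).
    apply (ex_RInt_continuous (V := R_CompleteNormedModule)).
    intros t _. now apply continuous_circle_angle. }
  assert (H2 := RInt_correct (V := R_CompleteNormedModule) _ _ _ (ex_RInt_circle_density s Hs)).
  assert (H3 := is_RInt_minus (V := R_NormedModule) _ _ _ _ _ _
    (is_RInt_scal (V := R_NormedModule) _ _ _ s _ H1) H2).
  apply (is_RInt_unique (V := R_CompleteNormedModule)) in H.
  apply (is_RInt_unique (V := R_CompleteNormedModule)) in H3.
  assert (E : circle_antiderivative s (2 * PI) = circle_antiderivative s 0).
  { unfold circle_antiderivative, circle.
    now rewrite cos_2PI, sin_2PI, cos_0, sin_0. }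
  assert (E2 : s * circle_mean_derivative s - circle_mean s =
    circle_antiderivative s (2 * PI) - circle_antiderivative s 0)
    by exact (eq_trans (eq_sym H3) H).
  lra.
Qed.

(** By the Euler relation [circle_mean a / a] has zero derivative for [a > 0], so its value at [s]
    is its limit as [a] tends to 0. That limit is the derivative at radius 0, where the circle
    collapses to [z]. The factor [2 PI] reflects that [circle_mean] is not normalised. *)
Lemma circle_mean_center (s : R) : 0 < s -> s + Cmod z < 1 ->
  circle_mean s = s * (2 * PI * fst (u * h z)%C).
Proof.
  intros Hs Hsz.
  set (l := 2 * PI * fst (u * h z)%C).
  assert (Hz : Rabs 0 + Cmod z < 1) by (rewrite Rabs_R0; lra).
  assert (Hl : circle_mean_derivative 0 = l).
  { unfold circle_mean_derivative.
    rewrite (RInt_ext _ (fun _ => fst (u * h z)%C)).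
    - rewrite RInt_const. unfold l. unfold scal; simpl; unfold mult; simpl. ring.
    - intros t _. f_equal. f_equal. f_equal. unfold circle.
      apply injective_projections; simpl; ring. }
  assert (Hconst : forall a, 0 < a < s -> circle_mean a / a = circle_mean s / s).
  { intros a Ha.
    apply (eq_is_derive (V := R_NormedModule) (fun x => circle_mean x / x)); [|lra].
    intros t Ht.
    assert (Htz : Rabs t + Cmod z < 1) by (rewrite Rabs_pos_eq by lra; lra).
    assert (HG := is_derive_circle_mean t Htz).
    assert (HD := is_derive_div circle_mean (fun x => x) t _ 1 HG (is_derive_id t)
      ltac:(lra)).
    replace (zero : R_NormedModule) with
      ((circle_mean_derivative t * t - circle_mean t * 1) / t ^ 2); [exact HD|].
    rewrite <- (circle_mean_euler t Htz). unfold zero; simpl. field. lra. }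
  assert (H0 := is_derive_circle_mean 0 Hz).
  rewrite Hl in H0. apply is_derive_Reals in H0.
  (* At radius 0 the Euler relation says that [circle_mean 0] vanishes, so the difference quotient
     at 0 is [circle_mean a / a]. *)
  assert (HG0 := circle_mean_euler 0 Hz).
  enough (circle_mean s / s = l) as <- by (field; lra).
  apply cond_eq. intros eps Heps.
  destruct (H0 eps Heps) as [d Hd].
  set (a := Rmin (d / 2) (s / 2)).
  assert (Hd0 := cond_pos d).
  assert (Ha : 0 < a) by (apply Rmin_pos; lra).
  assert (Ha1 : a <= d / 2) by apply Rmin_l. assert (Ha2 : a <= s / 2) by apply Rmin_r.
  specialize (Hd a ltac:(lra) ltac:(rewrite Rabs_pos_eq; lra)).
  rewrite Rplus_0_l, <- HG0, Rmult_0_l, Rminus_0_r, Hconst in Hd by lra.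
  exact Hd.
Qed.

End CauchyEstimate.

(** The unimodular [u] proportional to the conjugate of [h z] makes [u * h z] equal to [|h z|]. The
    circle integral is then [2 pi s |h z|], while its integrand is at most [M]. The case [h z = 0]
    is separate because [u] divides by [|h z|]. *)
Lemma cauchy_estimate (F h : C -> C) (z : C) (s M : R) :
  analytic h -> (forall w, disc w -> is_Cderive F w (h w)) ->
  0 < s -> s + Cmod z < 1 ->
  (forall w : C, Cmod (w - z)%C = s -> Cmod (F w) <= M) ->
  Cmod (h z) <= M / s.
Proof.
  intros Hh HF Hs Hsz HM.
  assert (Hcirc : forall t, Cmod (F (circle z s t)) <= M).
  { intros t. apply HM. rewrite circle_minus. apply Rabs_pos_eq. lra. }
  apply Rle_div_r; trivial.
  destruct (Ceq_dec (h z) 0) as [E|E].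
  { rewrite E, Cmod_0, Rmult_0_l.
    exact (Rle_trans _ _ _ (Cmod_ge_0 _) (Hcirc 0)). }
  assert (Hm : 0 < Cmod (h z)) by now apply Cmod_gt_0.
  set (u := (Cconj (h z) / Cmod (h z))%C).
  assert (Hm0 : RtoC (Cmod (h z)) <> RtoC 0).
  { intros H. apply RtoC_inj in H. lra. }
  assert (Hu : Cmod u = 1).
  { unfold u. rewrite Cmod_div, Cmod_conj, Cmod_R, Rabs_pos_eq by (trivial; lra).
    field. lra. }
  assert (Huh : (u * h z)%C = RtoC (Cmod (h z))).
  { unfold u. replace (Cconj (h z) / Cmod (h z) * h z)%C
      with (h z * Cconj (h z) / Cmod (h z))%C by (field; trivial).
    rewrite <- Cmod2_conj, RtoC_pow. field. trivial. }
  assert (Hsz' : Rabs s + Cmod z < 1) by (rewrite Rabs_pos_eq; lra).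
  assert (HG := circle_mean_center F h u z Hh HF (Req_le _ _ Hu) s Hs Hsz).
  rewrite Huh in HG. simpl fst in HG.
  assert (HI := RInt_correct (V := R_CompleteNormedModule) _ _ _
    (ex_RInt_circle_density F h u z HF s Hsz')).
  assert (HPI := PI_RGT_0).
  assert (HB : Rabs (circle_mean F u z s) <= (2 * PI - 0) * M).
  { refine (norm_RInt_le_const (V := R_NormedModule) _ 0 (2 * PI) _ M ltac:(lra) _ HI).
    intros t _. change (Rabs (circle_density F u z s t) <= M).
    unfold circle_density.
    eapply Rle_trans; [apply Rabs_fst_mult_le; lra|].
    rewrite Cmod_mult.
    replace (Cmod (cos t, (- sin t)%R)) with 1; [rewrite Rmult_1_r; apply Hcirc|].
    unfold Cmod. simpl. transitivity (sqrt 1); [now rewrite sqrt_1|]. f_equal.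
    generalize (sin2_cos2 t). unfold Rsqr. lra. }
  rewrite HG in HB. apply Rabs_le_between in HB.
  apply (Rmult_le_reg_l (2 * PI)); lra.
Qed.

(** * Weighted growth *)

Definition weighted_le (gamma : R) (F : C -> C) (N : R) : Prop :=
  forall z, disc z -> weighted gamma F z <= N.

Definition weighted_vanishing (gamma : R) (F : C -> C) : Prop :=
  forall eps : R, 0 < eps -> exists delta : R, 0 < delta /\
    forall z : C, 1 - delta < Cmod z < 1 -> weighted gamma F z < eps.

Lemma weighted_ge_0 (gamma : R) (F : C -> C) (z : C) : 0 <= weighted gamma F z.
Proof.
  apply Rmult_le_pos; [left; apply exp_pos|apply Cmod_ge_0].
Qed.

Lemma sup_disc_bounded (F : C -> R) :
  Rbar_lt (sup_disc F) p_infty <-> exists N, forall z, disc z -> F z <= N.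
Proof.
  unfold sup_disc. destruct (Lub_Rbar_correct
    (fun r : R => exists z : C, disc z /\ r = F z)) as [Hub Hlub].
  split.
  - destruct (Lub_Rbar _) as [l| |]; simpl.
    + intros _. exists l. intros z Hz. apply (Hub (F z)). now exists z.
    + easy.
    (* The supremum is not [m_infty] because the disc contains 0. *)
    + intros _. exfalso. apply (Hub (F 0)). exists (RtoC 0). split; [exact disc_0|easy].
  - intros [N HN]. apply (Rbar_le_lt_trans _ N); [|easy].
    apply Hlub. intros y [z [Hz ->]]. simpl. auto.
Qed.

Lemma sup_disc_correct (F : C -> R) :
  (exists N, forall z, disc z -> F z <= N) ->
  (forall z, disc z -> F z <= real (sup_disc F)) /\
  (forall N, (forall z, disc z -> F z <= N) -> real (sup_disc F) <= N).
Proof.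
  intros H. apply sup_disc_bounded in H. revert H.
  unfold sup_disc. destruct (Lub_Rbar_correct
    (fun r : R => exists z : C, disc z /\ r = F z)) as [Hub Hlub].
  assert (H0 := Hub (F 0) (ex_intro _ (RtoC 0) (conj disc_0 eq_refl))).
  destruct (Lub_Rbar _) as [l| |]; simpl; try easy.
  intros _. split.
  - intros z Hz. apply (Hub (F z)). now exists z.
  - intros N HN. apply (Hlub N). intros y [z [Hz ->]]. simpl. auto.
Qed.

(** A finite norm is itself an admissible bound, and the least one. Finiteness is assumed because
    [real] would send an infinite supremum to 0. *)
Lemma korenblum_norm_compare (gamma1 gamma2 c : R) (F1 F2 : C -> C) :
  (forall N, weighted_le gamma1 F1 N -> weighted_le gamma2 F2 (c * N)) ->
  (exists N, weighted_le gamma1 F1 N) ->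
  korenblum_norm gamma2 F2 <= c * korenblum_norm gamma1 F1.
Proof.
  intros Hc HN.
  assert (H1 := Hc _ (proj1 (sup_disc_correct _ HN))).
  apply (sup_disc_correct (weighted gamma2 F2)); [|exact H1].
  eexists. exact H1.
Qed.

Lemma Rpower_le_neg (x y a : R) : 0 < x <= y -> 0 <= a -> Rpower y (- a) <= Rpower x (- a).
Proof.
  intros Hxy Ha. rewrite !Rpower_Ropp.
  apply Rinv_le_contravar. apply exp_pos. now apply Rle_Rpower_l.
Qed.

Lemma weighted_le_iff (gamma : R) (F : C -> C) (z : C) (N : R) :
  weighted gamma F z <= N <-> Cmod (F z) <= N * Rpower (1 - Cmod z) (- gamma).
Proof.
  unfold weighted. rewrite Rpower_Ropp.
  assert (Hp : 0 < Rpower (1 - Cmod z) gamma) by apply exp_pos.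
  rewrite Rmult_comm.
  split; intros H.
  - apply Rle_div_r; trivial.
  - apply Rle_div_r in H; trivial.
Qed.


(** With [x = ((1 - t) + (1 - r)) / 2], a primitive in [t] of [x^(-gamma-1)] is
    [(2 / gamma) x^(-gamma)], and [x = (1 - r) / 2] at [t = 1] produces [2^gamma]. The added 1
    covers [z = 0], where the mean is [h(0)]. *)
Definition growth_const (gamma : R) : R := 2 / gamma * Rpower 2 gamma + 1.

Lemma growth_const_pos (gamma : R) : 0 < gamma -> 1 < growth_const gamma.
Proof.
  intros Hg. unfold growth_const.
  assert (0 < 2 / gamma * Rpower 2 gamma); [|lra].
  apply Rmult_lt_0_compat; [apply Rdiv_lt_0_compat; lra|apply exp_pos].
Qed.

(* [1 - t r >= ((1 - t) + (1 - r)) / 2] makes the integral of [(1 - t r)^(-gamma-1)]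
   explicit up to constants, uniformly for [r] near [0]. *)
Lemma mean_path_int_growth (h : C -> C) (gamma M N : R) (z : C) :
  analytic h -> 0 < gamma -> 0 <= M -> 0 <= N ->
  (forall w, disc w -> Cmod (h w) <= M + N * Rpower (1 - Cmod w) (- (gamma + 1))) ->
  disc z ->
  Cmod (mean_path_int h z) <= M + N * growth_const gamma * Rpower (1 - Cmod z) (- gamma).
Proof.
  intros Hh Hg HM HN Hhw Hz.
  assert (HC := growth_const_pos gamma Hg).
  unfold mean_path_int. destruct (Ceq_dec z 0) as [E|Hz0].
  { subst z. eapply Rle_trans; [apply Hhw, disc_0|].
    rewrite Cmod_0, Rminus_0_r. unfold Rpower. rewrite ln_1, !Rmult_0_r, exp_0. nra. }
  assert (Hr : 0 < Cmod z) by now apply Cmod_gt_0.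
  unfold disc in Hz. set (r := Cmod z) in *.
  rewrite Cmod_mult, Cmod_inv by trivial. fold r.
  rewrite Rmult_comm. apply Rle_div_l; trivial.
  rewrite path_int_segment.
  set (x := fun t : R => (2 - t - r) / 2).
  set (A := fun t => r * (M * t + N * (2 / gamma * Rpower (x t) (- gamma)))).
  assert (HA : is_RInt (fun t => r * (M + N * Rpower (x t) (- (gamma + 1)))) 0 1 (A 1 - A 0)).
  { assert (Hx : forall t, Rmin 0 1 <= t <= Rmax 0 1 -> 0 < x t).
    { intros t. rewrite Rmin_left, Rmax_right by lra. unfold x. lra. }
    apply (is_RInt_derive (V := R_CompleteNormedModule) A).
    - intros t Ht. specialize (Hx t Ht). unfold A, Rpower, x in *.
      auto_derive. lra.
      replace (- (gamma + 1) * ln ((2 - t - r) / 2))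
        with (- gamma * ln ((2 - t - r) / 2) + - ln ((2 - t - r) / 2)) by ring.
      rewrite exp_plus, exp_Ropp, exp_ln by lra.
      unfold Rdiv, Rminus in *. field. lra.
    - intros t Ht. specialize (Hx t Ht).
      apply (ex_derive_continuous (K := R_AbsRing) (V := R_NormedModule)).
      unfold Rpower, x in *. auto_derive. lra. }
  assert (HI := is_RInt_segment h 0 z Hh disc_0 Hz).
  apply Rle_trans with (A 1 - A 0).
  - rewrite Cmod_norm. refine (norm_RInt_le _ _ 0 1 _ _ Rle_0_1 _ HI HA).
    intros t Ht. rewrite <- Cmod_norm. unfold segment_integrand.
    replace (0 + RtoC t * (z - 0))%C with (RtoC t * z)%C by ring.
    replace (z - 0)%C with z by ring.
    rewrite Cmod_mult. fold r. rewrite Rmult_comm.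
    apply Rmult_le_compat_l; [lra|].
    assert (Htz : Cmod (t * z)%C = t * r) by (rewrite Cmod_mult, Cmod_R, Rabs_pos_eq by lra; easy).
    assert (Htr : t * r < 1) by nra.
    eapply Rle_trans; [apply Hhw; unfold disc; lra|].
    apply Rplus_le_compat_l, Rmult_le_compat_l; trivial.
    rewrite Htz. apply Rpower_le_neg; [|lra]. unfold x. split; nra.
  - assert (E : Rpower (x 1) (- gamma) = Rpower 2 gamma * Rpower (1 - r) (- gamma)).
    { unfold x, Rpower. replace ((2 - 1 - r) / 2) with ((1 - r) * / 2) by field.
      rewrite ln_mult, ln_Rinv by lra. rewrite <- exp_plus. f_equal. ring. }
    unfold A. rewrite E.
    assert (H0 : 0 < Rpower (x 0) (- gamma)) by apply exp_pos.
    assert (H1 : 0 < Rpower (1 - r) (- gamma)) by apply exp_pos.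
    assert (H2 : 0 < 2 / gamma) by (apply Rdiv_lt_0_compat; lra).
    set (p := Rpower (1 - r) (- gamma)) in *.
    unfold growth_const.
    assert (0 <= r * (N * p)) by (repeat apply Rmult_le_pos; lra).
    assert (0 <= r * (N * (2 / gamma * Rpower (x 0) (- gamma))))
      by (repeat apply Rmult_le_pos; lra).
    nra.
Qed.

(** On the circle of radius [s = (1 - |z|) / 2] one has [1 - |w| >= s], so [|F| <= N s^(-gamma)] and
    [|h z| <= N s^(-gamma-1)]; writing [1 - |z| = 2 s] gives the constant. Bounding [F] on that
    circle only lets the estimate serve the little-o spaces as well. *)
Lemma weighted_cauchy_local (F h : C -> C) (gamma N : R) (z : C) :
  analytic h -> (forall w, disc w -> is_Cderive F w (h w)) ->
  0 < gamma -> 0 <= N -> disc z ->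
  (forall w : C, Cmod (w - z)%C = (1 - Cmod z) / 2 -> weighted gamma F w <= N) ->
  weighted (gamma + 1) h z <= Rpower 2 (gamma + 1) * N.
Proof.
  intros Hh HF Hg HN Hz Hw. unfold disc in Hz.
  set (s := (1 - Cmod z) / 2).
  assert (Hs : 0 < s) by (unfold s; lra).
  assert (H : Cmod (h z) <= N * Rpower s (- gamma) / s).
  { apply (cauchy_estimate F h); trivial. unfold s; lra.
    intros w Hws. specialize (Hw w Hws).
    apply weighted_le_iff in Hw. eapply Rle_trans; [exact Hw|].
    apply Rmult_le_compat_l; trivial. apply Rpower_le_neg; [|lra].
    split; trivial.
    assert (Ht := Cmod_triangle (w - z) z).
    replace (w - z + z)%C with w in Ht by ring.
    rewrite Hws in Ht. unfold s in *. lra. }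
  apply weighted_le_iff. eapply Rle_trans; [exact H|]. right.
  replace (1 - Cmod z) with (2 * s) by (unfold s; field).
  unfold Rpower. rewrite ln_mult by lra.
  rewrite (Rmult_comm _ N), Rmult_assoc, <- exp_plus.
  unfold Rdiv. rewrite Rmult_assoc. f_equal.
  rewrite <- (exp_ln s) at 2 by trivial. rewrite <- exp_Ropp, <- exp_plus.
  f_equal. ring.
Qed.

(** Shaped for compactness of a square: [delta] is both the size of the neighbourhood and, inverted,
    the bound on [h], so a uniform lower bound on [delta] bounds [h]. A centre outside the closed
    disc gets a neighbourhood that misses it. *)
Lemma locally_bounded_closed_disc (h : C -> C) (r u v : R) :
  analytic h -> r < 1 ->
  exists delta : posreal, forall w : C,
    Rabs (fst w - u) < delta -> Rabs (snd w - v) < delta ->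
    Cmod w <= r -> Cmod (h w) <= / delta.
Proof.
  intros Hh Hr. set (q := (u, v) : C).
  assert (Hq : forall (w : C) d, Rabs (fst w - u) < d / 2 -> Rabs (snd w - v) < d / 2 ->
    Cmod (w - q)%C < d).
  { intros w d H1 H2. eapply Rle_lt_trans; [apply Cmod_le_Rabs|].
    simpl. unfold Rminus in *. lra. }
  destruct (Rle_lt_dec (Cmod q) r) as [Hqr|Hqr].
  - assert (Hqd : disc q) by (unfold disc; lra).
    destruct (analytic_eps_continuous h q Hh Hqd 1 Rlt_0_1) as [d [Hd H]].
    assert (H0 := Cmod_ge_0 (h q)).
    assert (Hm : 0 < Rmin (d / 2) (/ (Cmod (h q) + 1))).
    { apply Rmin_pos; [lra|]. apply Rinv_0_lt_compat. lra. }
    exists (mkposreal _ Hm). simpl. intros w H1 H2 _.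
    assert (Hwq : Cmod (w - q)%C < d).
    { apply Hq; eapply Rlt_le_trans; eauto; apply Rmin_l. }
    apply Rle_trans with (Cmod (h q) + 1).
    + assert (Ht := Cmod_triangle (h w - h q) (h q)).
      replace (h w - h q + h q)%C with (h w) in Ht by ring.
      generalize (H w Hwq). lra.
    + assert (Hi := Rinv_le_contravar _ _ Hm (Rmin_r _ _)).
      rewrite Rinv_inv in Hi. exact Hi.
  - assert (Hm : 0 < (Cmod q - r) / 2) by lra.
    exists (mkposreal _ Hm). simpl. intros w H1 H2 Hw. exfalso.
    assert (Hwq := Hq w _ H1 H2). rewrite Cmod_minus_sym in Hwq.
    assert (Ht := Cmod_triangle (q - w) w).
    replace (q - w + w)%C with q in Ht by ring. lra.
Qed.

Lemma analytic_bounded_closed_disc (h : C -> C) (r : R) :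
  analytic h -> r < 1 ->
  exists M, 0 < M /\ forall w, Cmod w <= r -> Cmod (h w) <= M.
Proof.
  intros Hh Hr.
  set (delta := fun u v => proj1_sig (constructive_indefinite_description _
    (locally_bounded_closed_disc h r u v Hh Hr))).
  destruct (compactness_value_2d (-1) 1 (-1) 1 delta) as [d Hd].
  exists (/ d). split; [apply Rinv_0_lt_compat, cond_pos|].
  (* The compactness result yields a nearby centre only under a double negation, hence the argument
     by contradiction. *)
  intros w Hw. apply Rnot_lt_le. intros Hlt.
  assert (H1 := re_le_Cmod w).
  assert (H2 := Rle_trans _ _ _ (Rmax_r _ _) (Rmax_Cmod w)).
  change (Re w) with (fst w) in H1.
  apply (Hd (fst w) (snd w)).
  { apply Rabs_le_between. lra. }
  { apply Rabs_le_between. lra. }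
  intros (u & v & _ & _ & Hu & Hv & Hduv).
  assert (H := proj2_sig (constructive_indefinite_description _
    (locally_bounded_closed_disc h r u v Hh Hr)) w Hu Hv Hw).
  change (Cmod (h w) <= / delta u v) in H.
  assert (H3 : / delta u v <= / d) by (apply Rinv_le_contravar; [apply cond_pos|trivial]).
  lra.
Qed.

(** Near the unit circle the weighted modulus is below 1, and the rest is a compact disc.
    Consequently norms on the little-o spaces are genuine finite suprema. *)
Lemma vanishing_bounded (gamma : R) (F : C -> C) :
  0 < gamma -> analytic F -> weighted_vanishing gamma F -> exists N, weighted_le gamma F N.
Proof.
  intros Hg HF Hv. destruct (Hv 1 Rlt_0_1) as [d [Hd H]].
  destruct (analytic_bounded_closed_disc F (1 - d) HF) as [M [HM HB]]; [lra|].
  exists (Rmax 1 M). intros z Hz. unfold disc in Hz.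
  destruct (Rle_lt_dec (Cmod z) (1 - d)) as [Hzd|Hzd].
  - eapply Rle_trans; [|apply Rmax_r]. unfold weighted.
    assert (Rpower (1 - Cmod z) gamma <= 1).
    { replace 1 with (Rpower 1 gamma) at 2
        by (unfold Rpower; now rewrite ln_1, Rmult_0_r, exp_0).
      apply Rle_Rpower_l; [lra|]. generalize (Cmod_ge_0 z). lra. }
    generalize (HB z Hzd), (Cmod_ge_0 (F z)). nra.
  - eapply Rle_trans; [|apply Rmax_l]. left. apply H. lra.
Qed.

(** * Embeddings of the optimal domains *)

Definition embeds (X Y : space) : Prop :=
  exists c, 0 < c /\
    forall f, carrier X f -> carrier Y f /\ snorm Y f <= c * snorm X f.

Lemma embeds_trans (X Y Z : space) : embeds X Y -> embeds Y Z -> embeds X Z.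
Proof.
  intros [c [Hc HXY]] [d [Hd HYZ]].
  exists (d * c). split; [now apply Rmult_lt_0_compat|].
  intros f Hf. destruct (HXY f Hf) as [HY H1]. destruct (HYZ f HY) as [HZ H2].
  split; trivial. nra.
Qed.

Lemma embeds_same_space (X Y : space) : embeds X Y -> embeds Y X -> same_space X Y.
Proof.
  intros [c [Hc HXY]] [d [Hd HYX]]. split.
  - intros f; split; intros Hf; [now apply HXY|now apply HYX].
  - exists (/ d), c. split; [now apply Rinv_0_lt_compat|]. split; trivial.
    intros f Hf. destruct (HXY f Hf) as [HY H1]. destruct (HYX f HY) as [_ H2].
    split; trivial. rewrite Rmult_comm. apply Rle_div_l; trivial. lra.
Qed.

Lemma weighted_mult_le (gamma K : R) (F1 F2 : C -> C) (z : C) :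
  Cmod (F2 z) <= K -> weighted gamma (fun w => F1 w * F2 w)%C z <= K * weighted gamma F1 z.
Proof.
  intros HK. unfold weighted. rewrite Cmod_mult.
  assert (H := weighted_ge_0 gamma F1 z). unfold weighted in H.
  nra.
Qed.

Lemma Vop_le_Top (g f : C -> C) (gamma : R) (z : C) :
  disc z -> weighted gamma (Vop g f) z <= weighted gamma (Top g f) z.
Proof.
  intros Hz. unfold weighted.
  apply Rmult_le_compat_l; [left; apply exp_pos|].
  unfold Top. destruct (Ceq_dec z 0) as [->|Hz0].
  - unfold Vop. rewrite path_int_0, Cmod_0. apply Cmod_ge_0.
  - change (Cmod (Vop g f z) <= Cmod (/ z * Vop g f z)%C).
    rewrite Cmod_mult, Cmod_inv by trivial.
    assert (Hm : 0 < Cmod z) by now apply Cmod_gt_0.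
    rewrite Rmult_comm. apply Rle_div_r; trivial.
    unfold disc in Hz. generalize (Cmod_ge_0 (Vop g f z)). nra.
Qed.

Lemma weighted_vanishing_le (gamma : R) (F1 F2 : C -> C) :
  (forall z, disc z -> weighted gamma F2 z <= weighted gamma F1 z) ->
  weighted_vanishing gamma F1 -> weighted_vanishing gamma F2.
Proof.
  intros H Hv eps Heps. destruct (Hv eps Heps) as [d [Hd HF]].
  exists d. split; trivial. intros z Hz.
  eapply Rle_lt_trans; [apply H; unfold disc; lra|auto].
Qed.

Lemma weighted_vanishing_mult (gamma K : R) (F1 F2 : C -> C) :
  0 < K -> (forall z, disc z -> Cmod (F2 z) <= K) ->
  weighted_vanishing gamma F1 -> weighted_vanishing gamma (fun w => F1 w * F2 w)%C.
Proof.
  intros HK H Hv eps Heps.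
  destruct (Hv (eps / K)) as [d [Hd HF]]; [now apply Rdiv_lt_0_compat|].
  exists d. split; trivial. intros z Hz.
  eapply Rle_lt_trans; [apply weighted_mult_le, H; unfold disc; lra|].
  rewrite Rmult_comm. apply Rlt_div_r; auto.
Qed.

Lemma weighted_vanishing_derivative (F h : C -> C) (gamma : R) :
  analytic h -> (forall w, disc w -> is_Cderive F w (h w)) ->
  0 < gamma -> weighted_vanishing gamma F -> weighted_vanishing (gamma + 1) h.
Proof.
  intros Hh HF Hg Hv eps Heps.
  set (c := Rpower 2 (gamma + 1)). assert (Hc : 0 < c) by apply exp_pos.
  assert (Heps' : 0 < eps / (2 * c)) by (apply Rdiv_lt_0_compat; lra).
  destruct (Hv _ Heps') as [d [Hd H]].
  (* If [|z| > 1 - d / 2], the circle of radius [(1 - |z|) / 2] around [z] stays in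
     [|w| > 1 - 3 d / 4], inside the zone where [F] is controlled. *)
  exists (d / 2). split; [lra|]. intros z Hz.
  apply Rle_lt_trans with (c * (eps / (2 * c))).
  - apply (weighted_cauchy_local F h); trivial; [lra|unfold disc; lra|].
    intros w Hw. left. apply H.
    assert (H1 := Cmod_triangle (w - z) z). replace (w - z + z)%C with w in H1 by ring.
    assert (H2 := Cmod_triangle (z - w) w). replace (z - w + w)%C with z in H2 by ring.
    rewrite Cmod_minus_sym in H2. lra.
  - replace (c * (eps / (2 * c))) with (eps / 2) by (field; lra). lra.
Qed.

(** A compact disc and the vanishing near the circle together give
    [|h w| <= M + e (1 - |w|)^(-gamma-1)]. After integration and weighting, the second term is at
    most [eps / 2], and the first is at most [M (1 - |z|)^gamma], which tends to 0. *)
Lemma weighted_vanishing_mean_path_int (h : C -> C) (gamma : R) :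
  analytic h -> 0 < gamma ->
  weighted_vanishing (gamma + 1) h -> weighted_vanishing gamma (mean_path_int h).
Proof.
  intros Hh Hg Hv eps Heps.
  set (c := growth_const gamma). assert (Hc : 1 < c) by now apply growth_const_pos.
  set (e := eps / (2 * c)). assert (He : 0 < e) by (apply Rdiv_lt_0_compat; lra).
  destruct (Hv e He) as [d [Hd H]].
  destruct (analytic_bounded_closed_disc h (1 - d) Hh) as [M [HM HB]]; [lra|].
  (* Solves [M delta^gamma = eps / 2]. *)
  exists (Rpower (eps / (2 * M)) (/ gamma)). split; [apply exp_pos|].
  intros z Hz.
  assert (Hzd : disc z) by (unfold disc; lra).
  assert (HT := mean_path_int_growth h gamma M e z Hh Hg (Rlt_le _ _ HM) (Rlt_le _ _ He)).
  fold c in HT.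
  assert (Hp : Rpower (1 - Cmod z) gamma < eps / (2 * M)).
  { apply Rlt_le_trans with (Rpower (Rpower (eps / (2 * M)) (/ gamma)) gamma).
    - apply Rlt_Rpower_l; lra.
    - right. rewrite Rpower_mult, Rinv_l, Rpower_1; [easy| |lra].
      apply Rdiv_lt_0_compat; lra. }
  assert (Hp0 : 0 < Rpower (1 - Cmod z) gamma) by apply exp_pos.
  unfold weighted. set (p := Rpower (1 - Cmod z) gamma) in *.
  apply Rle_lt_trans with (p * (M + e * c * Rpower (1 - Cmod z) (- gamma))).
  - apply Rmult_le_compat_l; [lra|]. apply HT; trivial.
    intros w Hw.
    assert (H0 : 0 < Rpower (1 - Cmod w) (- (gamma + 1))) by apply exp_pos.
    destruct (Rle_lt_dec (Cmod w) (1 - d)) as [Hwd|Hwd].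
    + generalize (HB w Hwd). nra.
    + assert (Hw' := Rlt_le _ _ (H w (conj Hwd Hw))).
      apply weighted_le_iff in Hw'. lra.
  - rewrite Rpower_Ropp. fold p.
    replace (p * (M + e * c * / p)) with (p * M + eps / 2) by (unfold e; field; lra).
    apply (Rmult_lt_compat_r M) in Hp; trivial.
    replace (eps / (2 * M) * M) with (eps / 2) in Hp by (field; lra).
    lra.
Qed.

(** * The cycle of embeddings for a fixed symbol [g] *)

Section OptimalDomains.

Context (gamma K1 K2 : R) (g : C -> C) (hgamma : 0 < gamma)
  (HK1 : 0 < K1) (HK2 : 0 < K2) (Hg : analytic (C_derive g))
  (Hgz : forall z, disc z -> C_derive g z <> RtoC 0)
  (Hg1 : forall z, disc z -> Cmod (C_derive g z) <= K1)
  (Hg2 : forall z, disc z -> Cmod (/ C_derive g z)%C <= K2).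

Definition integrand (f : C -> C) (xi : C) : C := (f xi * C_derive g xi)%C.

Lemma analytic_integrand (f : C -> C) : analytic f -> analytic (integrand f).
Proof. intros Hf. now apply analytic_mult. Qed.

Lemma analytic_Vop (f : C -> C) : analytic f -> analytic (Vop g f).
Proof. intros Hf. now apply analytic_path_int, analytic_integrand. Qed.

Lemma analytic_Top (f : C -> C) : analytic f -> analytic (Top g f).
Proof. intros Hf. exact (analytic_mean_path_int _ (analytic_integrand f Hf)). Qed.

Lemma is_Cderive_Vop (f : C -> C) : analytic f ->
  forall w, disc w -> is_Cderive (Vop g f) w (integrand f w).
Proof. intros Hf w Hw. now apply is_Cderive_path_int; [apply analytic_integrand|]. Qed.

Lemma weighted_integrand_cancel (a : R) (f : C -> C) (z : C) : disc z ->
  weighted a f z = weighted a (fun w => integrand f w * / C_derive g w)%C z.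
Proof.
  intros Hz. unfold weighted, integrand. do 2 f_equal. field. now apply Hgz.
Qed.

Lemma Vop_weighted_le (f : C -> C) (N : R) :
  weighted_le gamma (Top g f) N -> weighted_le gamma (Vop g f) (1 * N).
Proof.
  intros H z Hz. rewrite Rmult_1_l. eapply Rle_trans; [now apply Vop_le_Top|auto].
Qed.

Lemma function_weighted_le (f : C -> C) (N : R) : analytic f ->
  weighted_le gamma (Vop g f) N -> weighted_le (gamma + 1) f (K2 * Rpower 2 (gamma + 1) * N).
Proof.
  intros Hf H z Hz. rewrite weighted_integrand_cancel by trivial.
  eapply Rle_trans; [apply weighted_mult_le, Hg2, Hz|].
  rewrite Rmult_assoc. apply Rmult_le_compat_l; [lra|].
  apply (weighted_cauchy_local (Vop g f)); trivial.
  - now apply analytic_integrand.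
  - now apply is_Cderive_Vop.
  - exact (Rle_trans _ _ _ (weighted_ge_0 _ _ _) (H 0 disc_0)).
  - intros w Hw. apply H. unfold disc in *.
    assert (Ht := Cmod_triangle (w - z) z). replace (w - z + z)%C with w in Ht by ring. lra.
Qed.

Lemma Top_weighted_le (f : C -> C) (N : R) : analytic f ->
  weighted_le (gamma + 1) f N -> weighted_le gamma (Top g f) (K1 * growth_const gamma * N).
Proof.
  intros Hf H z Hz. apply weighted_le_iff.
  assert (HN : 0 <= N) by exact (Rle_trans _ _ _ (weighted_ge_0 _ _ _) (H 0 disc_0)).
  replace (K1 * growth_const gamma * N * Rpower (1 - Cmod z) (- gamma))
    with (0 + (K1 * N) * growth_const gamma * Rpower (1 - Cmod z) (- gamma)) by ring.
  apply (mean_path_int_growth (integrand f)); trivial.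
  - now apply analytic_integrand.
  - lra.
  - apply Rmult_le_pos; lra.
  - intros w Hw. rewrite Rplus_0_l. apply weighted_le_iff.
    eapply Rle_trans; [apply weighted_mult_le, Hg1, Hw|].
    apply Rmult_le_compat_l; [lra|auto].
Qed.

Lemma carrier_korenblum (a : R) (F : C -> C) :
  carrier (korenblum a) F <-> analytic F /\ exists N, weighted_le a F N.
Proof. simpl. now rewrite sup_disc_bounded. Qed.

Lemma korenblum0_sub (a : R) (F : C -> C) : 0 < a ->
  carrier (korenblum0 a) F -> carrier (korenblum a) F.
Proof.
  intros Ha [HF Hv]. apply (proj2 (carrier_korenblum a F)). split; trivial. now apply vanishing_bounded.
Qed.

Lemma embeds_Top_Vop :
  embeds (optimal_domain (Top g) (korenblum gamma)) (optimal_domain (Vop g) (korenblum gamma)).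
Proof.
  exists 1. split; [lra|]. intros f [Hf HC].
  destruct (proj1 (carrier_korenblum gamma (Top g f)) HC) as [_ HT]. split.
  - split; trivial. apply (proj2 (carrier_korenblum gamma (Vop g f))).
    split; [now apply analytic_Vop|].
    destruct HT as [N HN]. eexists. exact (Vop_weighted_le f N HN).
  - exact (korenblum_norm_compare gamma gamma 1 (Top g f) (Vop g f) (Vop_weighted_le f) HT).
Qed.

Lemma embeds_Vop_korenblum :
  embeds (optimal_domain (Vop g) (korenblum gamma)) (korenblum (gamma + 1)).
Proof.
  exists (K2 * Rpower 2 (gamma + 1)).
  split; [apply Rmult_lt_0_compat; [lra|apply exp_pos]|]. intros f [Hf HC].
  destruct (proj1 (carrier_korenblum gamma (Vop g f)) HC) as [_ HV]. split.
  - apply (proj2 (carrier_korenblum (gamma + 1) f)). split; trivial.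
    destruct HV as [N HN]. eexists. exact (function_weighted_le f N Hf HN).
  - exact (korenblum_norm_compare gamma (gamma + 1) _ (Vop g f) f
      (fun N => function_weighted_le f N Hf) HV).
Qed.

Lemma embeds_korenblum_Top :
  embeds (korenblum (gamma + 1)) (optimal_domain (Top g) (korenblum gamma)).
Proof.
  exists (K1 * growth_const gamma).
  split; [generalize (growth_const_pos gamma hgamma); nra|]. intros f HC.
  destruct (proj1 (carrier_korenblum (gamma + 1) f) HC) as [Hf HK]. split.
  - split; trivial. apply (proj2 (carrier_korenblum gamma (Top g f))).
    split; [now apply analytic_Top|].
    destruct HK as [N HN]. eexists. exact (Top_weighted_le f N Hf HN).
  - exact (korenblum_norm_compare (gamma + 1) gamma _ f (Top g f)
      (fun N => Top_weighted_le f N Hf) HK).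
Qed.

(** The little-o spaces carry the same norms as the large ones and are contained in them, so the
    norm inequality is inherited; what remains is the vanishing at the unit circle. The next two
    embeddings follow the same pattern. *)
Lemma embeds0_Top_Vop :
  embeds (optimal_domain (Top g) (korenblum0 gamma)) (optimal_domain (Vop g) (korenblum0 gamma)).
Proof.
  destruct embeds_Top_Vop as [c [Hc H]]. exists c. split; trivial. intros f [Hf HT].
  destruct (H f (conj Hf (korenblum0_sub gamma _ hgamma HT))) as [_ Hn].
  split; [|exact Hn]. split; trivial. split; [now apply analytic_Vop|].
  apply (weighted_vanishing_le gamma (Top g f)); [|exact (proj2 HT)].
  intros z. apply Vop_le_Top.
Qed.

Lemma embeds0_Vop_korenblum :
  embeds (optimal_domain (Vop g) (korenblum0 gamma)) (korenblum0 (gamma + 1)).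
Proof.
  destruct embeds_Vop_korenblum as [c [Hc H]]. exists c. split; trivial. intros f [Hf HV].
  destruct (H f (conj Hf (korenblum0_sub gamma _ hgamma HV))) as [_ Hn].
  split; [|exact Hn]. split; trivial.
  apply (weighted_vanishing_le _ (fun w => integrand f w * / C_derive g w)%C).
  - intros z Hz. right. now apply weighted_integrand_cancel.
  - apply (weighted_vanishing_mult _ K2); trivial.
    apply (weighted_vanishing_derivative (Vop g f)); trivial.
    + now apply analytic_integrand.
    + now apply is_Cderive_Vop.
    + exact (proj2 HV).
Qed.

Lemma embeds0_korenblum_Top :
  embeds (korenblum0 (gamma + 1)) (optimal_domain (Top g) (korenblum0 gamma)).
Proof.
  destruct embeds_korenblum_Top as [c [Hc H]]. exists c. split; trivial. intros f HK.
  destruct (H f (korenblum0_sub (gamma + 1) f ltac:(lra) HK)) as [_ Hn].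
  destruct HK as [Hf HK].
  split; [|exact Hn]. split; trivial. split; [now apply analytic_Top|].
  apply (weighted_vanishing_mean_path_int (integrand f)); trivial.
  - now apply analytic_integrand.
  - now apply (weighted_vanishing_mult _ K1).
Qed.

End OptimalDomains.

Lemma sup_disc_bound_pos (F : C -> R) :
  Rbar_lt (sup_disc F) p_infty -> exists K, 0 < K /\ forall z, disc z -> F z <= K.
Proof.
  intros H. apply sup_disc_bounded in H as [K HK].
  exists (Rmax K 1). split.
  - eapply Rlt_le_trans; [apply Rlt_0_1|apply Rmax_r].
  - intros z Hz. eapply Rle_trans; [auto|apply Rmax_l].
Qed.

Theorem corollary3p8 (gamma : R) (g : C -> C)
    (hgamma : 0 < gamma)
    (hB : Bloch g)
    (hnc : nonconstant g)
    (hg : Hinf (C_derive g))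
    (hginv : recip_Hinf (C_derive g)) :
  (same_space (optimal_domain (Vop g) (korenblum gamma))
              (optimal_domain (Top g) (korenblum gamma)) /\
   same_space (optimal_domain (Top g) (korenblum gamma))
              (korenblum (gamma + 1))) /\
  (same_space (optimal_domain (Vop g) (korenblum0 gamma))
              (optimal_domain (Top g) (korenblum0 gamma)) /\
   same_space (optimal_domain (Top g) (korenblum0 gamma))
              (korenblum0 (gamma + 1))).
Proof.
  destruct hg as [Hg Hg1]. destruct hginv as [Hgz [_ Hg2]].
  apply sup_disc_bound_pos in Hg1 as [K1 [HK1 Hg1]].
  apply sup_disc_bound_pos in Hg2 as [K2 [HK2 Hg2]].
  assert (TV := embeds_Top_Vop gamma g Hg).
  assert (VK := embeds_Vop_korenblum gamma K2 g hgamma HK2 Hg Hgz Hg2).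
  assert (KT := embeds_korenblum_Top gamma K1 g hgamma HK1 Hg Hg1).
  assert (TV0 := embeds0_Top_Vop gamma g hgamma Hg).
  assert (VK0 := embeds0_Vop_korenblum gamma K2 g hgamma HK2 Hg Hgz Hg2).
  assert (KT0 := embeds0_korenblum_Top gamma K1 g hgamma HK1 Hg Hg1).
  (* Each equality pairs one edge of the cycle with the composite of the other two. *)
  split; split; apply embeds_same_space; eauto using embeds_trans.
Qed.
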